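(* Let $\mathcal{M}$ be the family of $3$-graphs defined in the context. There exists $\epsilon_0>0$ such that for every $0<\epsilon<\epsilon_0$ there exists $n_0$ such that for all $n\ge n_0$ the following holds: every $\mathcal{M}$-free $3$-graph $\mathcal{H}$ with $n$ vertices and at least $2n^3/27-\epsilon n^3$ edges contains a set $W\subseteq V(\mathcal{H})$ with $|W|>n-3\epsilon^{1/2}n$ such that $\delta(\mathcal{H}[W])\ge 2n^2/9-20\epsilon^{1/2}n^2$ and $\mathcal{H}[W]$ is either semibipartite or $\mathcal{G}^2_6$-colorable.
   Context: An $r$-graph is an $r$-uniform hypergraph; $\mathcal{F}$-free means containing no member of $\mathcal{F}$ as a subgraph; ''contained in'' means isomorphic to a subgraph of. $\delta(\mathcal{H})$ is the minimum degree, the degree of a vertex being the number of edges containing it; $\mathcal{H}[W]$ is the induced subgraph on $W$. Transversal number $\tau(\mathcal{H})$: minimum size of a vertex set meeting every edge ($0$ if no edges). For $\ell\ge3$, $\mathcal{K}^3_{\ell+1}$: all $3$-graphs $F$ on at most $(\ell+1)+\binom{\ell+1}{2}$ vertices having an $(\ell+1)$-set $S$ (a core) every pair of which lies in an edge of $F$. Blowup of a $3$-graph $\mathcal{T}$ on $[s]$: replace vertex $i$ by a set of size $t_i\ge1$ (pairwise disjoint), each edge by the complete $3$-partite $3$-graph on the corresponding sets. $\mathcal{G}^1_n$: disjoint $A,B$, $|A|=\lfloor n/3\rfloor$, $|B|=\lceil 2n/3\rceil$, edges $\{a,b,b'\}$ with $a\in A$, $\{b,b'\}\subseteq B$. $\mathcal{G}^2_6$: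 all triples of $[6]$ except $\{1,2,3\},\{1,2,6\},\{3,4,5\},\{4,5,6\}$; for $n>6$, $\mathcal{G}^2_n$ is a blowup of $\mathcal{G}^2_6$ on $n$ vertices with maximum number of edges. $\mathcal{M}=M_1\cup M_2\cup M_3$ with $M_1=\{K_5^{3-}\}$ (complete $3$-graph on $5$ vertices minus an edge), $M_2$ = all $F\in\mathcal{K}^3_7$ with a core $S$ such that $\tau(F[S])\ge2$, $M_3$ = all $F\in\mathcal{K}^3_6$ not contained in $\mathcal{G}^1_n$ for any $n\ge1$ and not contained in $\mathcal{G}^2_n$ for any $n\ge6$. A $3$-graph is semibipartite if its vertex set has a partition $A\cup B$ with $|E\cap A|=1$, $|E\cap B|=2$ for every edge $E$; it is $\mathcal{G}^2_6$-colorable if it is a subgraph of a blowup of $\mathcal{G}^2_6$. *)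

(* Defs.v *)
From mathcomp Require Import all_boot.
From Stdlib Require Import Reals.
Set Implicit Arguments. Unset Strict Implicit. Unset Printing Implicit Defensive.

Definition is3graph (V : finType) (H : {set {set V}}) : Prop :=
  forall e, e \in H -> #|e| = 3.

Definition contained (U V : finType) (F : {set {set U}}) (H : {set {set V}}) : Prop :=
  exists f : U -> V, injective f /\ forall e, e \in F -> f @: e \in H.

Definition containedOn (V U : finType) (W : {set V}) (H : {set {set V}})
  (B : {set {set U}}) : Prop :=
  exists f : V -> U, {in W &, injective f} /\
    forall e, e \in H -> e \subset W -> f @: e \in B.

Definition induced (V : finType) (H : {set {set V}}) (S : {set V}) : {set {set V}} :=
  [set e in H | e \subset S].

Definition tau (V : finType) (H : {set {set V}}) : nat :=
  \big[minn/#|V|]_(T : {set V} | [forall e in H, T :&: e != set0]) #|T|.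

Definition degIn (V : finType) (H : {set {set V}}) (W : {set V}) (v : V) : nat :=
  #|[set e in H | (e \subset W) && (v \in e)]|.

(* blowup of a 3-graph T on 'I_s along a part map p : U -> 'I_s
   (vertex i replaced by the class p^-1(i)); edges = complete 3-partite triples
   over edges of T. *)
Definition blowupE (s : nat) (U : finType) (p : U -> 'I_s) (T : {set {set 'I_s}})
  : {set {set U}} :=
  [set e : {set U} | (#|e| == 3) && (#|p @: e| == 3) && (p @: e \in T)].

Definition surjP (s : nat) (U : finType) (p : U -> 'I_s) : Prop :=
  forall i : 'I_s, exists u, p u = i.

Definition K5minus : {set {set 'I_5}} :=
  [set e : {set 'I_5} | (#|e| == 3) &&
     (e != [set (inord 0 : 'I_5); inord 1; inord 2])].

(* G^2_6 on vertices 0..5 (paper's i is our i-1): all triples except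
   {1,2,3},{1,2,6},{3,4,5},{4,5,6} *)
Definition G26 : {set {set 'I_6}} :=
  [set e : {set 'I_6} | (#|e| == 3) &&
     (e \notin [set [set (inord 0 : 'I_6); inord 1; inord 2];
                    [set (inord 0 : 'I_6); inord 1; inord 5];
                    [set (inord 2 : 'I_6); inord 3; inord 4];
                    [set (inord 3 : 'I_6); inord 4; inord 5]])].

(* G^1_n on 'I_n: A = {x < n/3} (floor), B = the rest (size ceil(2n/3));
   edges {a,b,b'} with a in A, b <> b' in B *)
Definition G1 (n : nat) : {set {set 'I_n}} :=
  [set e : {set 'I_n} | (#|e| == 3) && (#|[set x in e | x < n %/ 3]| == 1)].

Definition maxG26blowup (n : nat) (p : 'I_n -> 'I_6) : Prop :=
  surjP p /\ forall q : 'I_n -> 'I_6, surjP q ->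
    #|blowupE q G26| <= #|blowupE p G26|.

Definition isCore (m l : nat) (F : {set {set 'I_m}}) (S : {set 'I_m}) : Prop :=
  #|S| = l.+1 /\
  forall x y, x \in S -> y \in S -> x != y -> exists2 e, e \in F & (x \in e) && (y \in e).

Definition inK (l m : nat) (F : {set {set 'I_m}}) : Prop :=
  is3graph F /\ m <= l.+1 + 'C(l.+1, 2) /\ exists S, isCore l F S.

Definition inM2 (m : nat) (F : {set {set 'I_m}}) : Prop :=
  inK 6 F /\ exists S, isCore 6 F S /\ 2 <= tau (induced F S).

Definition inM3 (m : nat) (F : {set {set 'I_m}}) : Prop :=
  inK 5 F /\
  (forall n, 1 <= n -> ~ contained F (G1 n)) /\
  (forall n (p : 'I_n -> 'I_6), 6 <= n -> maxG26blowup p ->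
      ~ contained F (blowupE p G26)).

Definition Mfree (V : finType) (H : {set {set V}}) : Prop :=
  ~ contained K5minus H /\
  (forall m (F : {set {set 'I_m}}), inM2 F -> ~ contained F H) /\
  (forall m (F : {set {set 'I_m}}), inM3 F -> ~ contained F H).

Definition semibipartiteOn (V : finType) (H : {set {set V}}) (W : {set V}) : Prop :=
  exists A : {set V}, A \subset W /\
    forall e, e \in H -> e \subset W ->
      #|e :&: A| = 1 /\ #|e :&: (W :\: A)| = 2.

Definition G26colorableOn (V : finType) (H : {set {set V}}) (W : {set V}) : Prop :=
  exists (U : finType) (p : U -> 'I_6), surjP p /\ containedOn W H (blowupE p G26).

(* Main.v *)
Require Import Defs.
From mathcomp Require Import all_boot zify.
From Stdlib Require Import Reals Lra Classical.
(* Reals rebinds the power notation of nat_scope; this restores the one of ssrnat. *)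
From mathcomp Require Import ssrnat.
Set Implicit Arguments. Unset Strict Implicit. Unset Printing Implicit Defensive.

(** Replacing a vertex v by a clone of a non-adjacent vertex u keeps a 3-graph
    free of the family, and the right choice of u and v never loses edges, so
    the process ends in a 3-graph whose non-adjacent vertices are twins.  Picking
    one vertex per twin class gives a 2-covered 3-graph, which is a star (seven
    or more classes, M_2), a subgraph of a semibipartite 3-graph or of G^2_6
    (six classes, M_3), or has at most five vertices and embeds into G^2_6
    (M_1).  Hence it is colourable, i.e. semibipartite or G^2_6-colourable, and
    has at most 2n^3/27 edges.

    Undoing one cloning step changes one vertex only, so it is enough to extend
    a colouring of W, where all vertices have nearly maximal degree in W, to one
    more vertex v.  There, a random 6-tuple z of vertices of the right colours
    spans a core in which every colouring is forced, up to automorphism, on any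
    twelve prescribed vertices of W.  If no colour t suits v, there is for each t
    an edge {v, x_t, y_t} forbidding it; z, v and these x_t, y_t span at most 19
    vertices that cannot be coloured, against the freeness from M_3. *)

(** * Ternary relations and colourings *)

(** Edge sets are replaced by relations [h] because cloning, blowing up and passing to induced
    subgraphs then all become composition with a map of vertices, under which the record [good] is
    stable. The obstacle is that the number of cloning steps is not controlled by [eps], so no error
    may accumulate along the chain. Hence the induction never tracks a set of exceptions: its claim
    is that all vertices above a fixed degree threshold can be coloured. One step discards the low
    vertices of the relation and of its clone, each less than 3 sqrt(eps) n in number, and the
    cloned vertex; then every vertex that is high in the relation itself is put back, so the next
    step starts afresh. Putting back relies on the core being covered from inside: each pair of the
    6-tuple lies in a triple of the tuple, so covering costs no further vertices and the bound 21 of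
    M_3 leaves room for the vertices that witness the obstructions. *)

Record sym3 (V : Type) (h : V -> V -> V -> bool) : Prop := Sym3 {
  sym3l : forall x y z, h x y z = h y x z;
  sym3r : forall x y z, h x y z = h x z y;
  sym3i : forall x z, h x x z = false }.

Definition exactly_one (a b c : bool) : bool := a + b + c == 1.

Definition g26 (i j k : 'I_6) : bool := [set i; j; k] \in G26.

Definition coloring (C V : finType) (al : C -> C -> C -> bool)
    (h : V -> V -> V -> bool) (X : {set V}) (c : V -> C) : Prop :=
  forall x y z, x \in X -> y \in X -> z \in X -> h x y z -> al (c x) (c y) (c z).

Definition colorable (V : finType) (h : V -> V -> V -> bool) (X : {set V}) : Prop :=
  (exists c, coloring exactly_one h X c) \/ (exists c, coloring g26 h X c).

(** Contrapositive forms of freeness from M_1, M_2 and M_3. In [good_K5] only the triple of [a],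
    [b], [c] is left out; the bound 21 is 6 + 15, six core vertices and one witness for each of
    their pairs. *)
Record good (V : finType) (h : V -> V -> V -> bool) : Prop := Good {
  good_sym : sym3 h;
  good_K5 : forall a b c d e,
    h a b d -> h a b e -> h a c d -> h a c e -> h b c d -> h b c e ->
    h a d e -> h b d e -> h c d e -> False;
  good_core7 : forall S : {set V}, #|S| = 7 ->
    (forall x y, x \in S -> y \in S -> x != y -> exists w, h x y w) ->
    exists t, forall x y z, x \in S -> y \in S -> z \in S -> h x y z ->
      t \in [:: x; y; z];
  good_core6 : forall S X : {set V}, S \subset X -> #|S| = 6 -> #|X| <= 21 ->
    (forall x y, x \in S -> y \in S -> x != y -> exists2 w, w \in X & h x y w) ->
    colorable h X }.

Lemma sym3_neq (V : eqType) (h : V -> V -> V -> bool) x y z :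
  sym3 h -> h x y z -> [/\ x != y, x != z & y != z].
Proof.
move=> sh hxyz; split; apply/eqP => E; move: hxyz; rewrite E.
- by rewrite (sym3i sh).
- by rewrite (sym3r sh) (sym3i sh).
- by rewrite (sym3l sh) (sym3r sh) (sym3i sh).
Qed.

Lemma sym3_pullback (U V : Type) (h : V -> V -> V -> bool) (f : U -> V) :
  sym3 h -> sym3 (fun x y z => h (f x) (f y) (f z)).
Proof. by case=> a b c; split=> *; [exact: a | exact: b | exact: c]. Qed.

Lemma colorable_sub (V : finType) (h : V -> V -> V -> bool) (X Y : {set V}) :
  X \subset Y -> colorable h Y -> colorable h X.
Proof.
by move=> /subsetP XY [[c hc]|[c hc]]; [left|right]; exists c => x y z /XY ? /XY ? /XY ?; apply: hc.
Qed.

(* Blowing up vertices, and passing to induced subgraphs, are both pullbacks. *)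
Lemma good_pullback (U V : finType) (h : V -> V -> V -> bool) (f : U -> V) :
  good h -> good (fun x y z => h (f x) (f y) (f z)).
Proof.
move=> gh; have sh := good_sym gh.
(* Covered vertices have distinct images, since no triple repeats a vertex; so a core maps to a core
   of the same size. *)
have injS (S : {set U}) : (forall x y, x \in S -> y \in S -> x != y ->
    exists w, h (f x) (f y) (f w)) -> {in S &, injective f}.
  move=> cS x y xS yS fxy; apply/eqP/negPn/negP => /(cS x y xS yS) [w].
  by rewrite fxy (sym3i sh).
split.
- exact: sym3_pullback.
- by move=> a b c d e; apply: (good_K5 gh).
- move=> S S7 cS; have fi := injS _ cS.
  have [||t Ht] := good_core7 gh (S := f @: S); first by rewrite card_in_imset.
    move=> _ _ /imsetP[x xS ->] /imsetP[y yS ->] xy.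
    have [|w hw] := cS x y xS yS; last by exists (f w).
    by apply: contraNneq xy => ->.
  have tP x y z : x \in S -> y \in S -> z \in S -> h (f x) (f y) (f z) ->
      t \in [:: f x; f y; f z].
    by move=> *; apply: Ht => //; exact: imset_f.
  (* If the apex lies outside the image, [S] spans no triple and any vertex of [S] will do. *)
  case: (boolP (t \in f @: S)) => [/imsetP[t' t'S ->{}]|tN] in tP *.
    exists t' => x y z xS yS zS hxyz; have := tP x y z xS yS zS hxyz.
    by rewrite !inE => /or3P[] /eqP /fi ->; rewrite ?eqxx ?orbT.
  have [x0 x0S] : exists x0, x0 \in S by apply/set0Pn; rewrite -card_gt0 S7.
  exists x0 => x y z xS yS zS hxyz; move: (tP x y z xS yS zS hxyz) tN.
  by rewrite !inE => /or3P[] /eqP ->; rewrite imset_f.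
- move=> S X SX S6 X21 cS.
  have fi : {in S &, injective f}.
    by apply: injS => x y xS yS xy; have [w _ ?] := cS x y xS yS xy; exists w.
  have [||||[c Hc]|[c Hc]] := good_core6 gh (S := f @: S) (X := f @: X).
  + exact: imsetS.
  + by rewrite card_in_imset.
  + exact: leq_trans (leq_imset_card _ _) X21.
  + move=> _ _ /imsetP[x xS ->] /imsetP[y yS ->] xy.
    have [|w wX hw] := cS x y xS yS; first by apply: contraNneq xy => ->.
    by exists (f w) => //; exact: imset_f.
  + by left; exists (c \o f) => x y z xX yX zX hxyz; apply: Hc => //; exact: imset_f.
  + by right; exists (c \o f) => x y z xX yX zX hxyz; apply: Hc => //; exact: imset_f.
Qed.

(** * Three-element sets and the edges of [G26] *)

Lemma imset_set3 (U V : finType) (f : U -> V) x y z :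
  f @: [set x; y; z] = [set f x; f y; f z].
Proof. by rewrite !imsetU !imset_set1. Qed.

Lemma cards3P (T : finType) (A : {set T}) : #|A| = 3 ->
  exists x y z, [/\ x != y, x != z, y != z & A = [set x; y; z]].
Proof.
move=> A3; have [x xA] : exists x, x \in A by apply/set0Pn; rewrite -card_gt0 A3.
have /cards2P[y [z [yz E]]] : #|A :\ x| == 2 by move: (cardsD1 x A); rewrite xA A3; lia.
have : x \notin A :\ x by rewrite !inE eqxx.
rewrite E !inE negb_or => /andP[xy xz]; exists x, y, z; split=> //.
by rewrite -(setD1K xA) E setUA.
Qed.

Lemma cards3 (T : finType) (x y z : T) :
  x != y -> x != z -> y != z -> #|[set x; y; z]| = 3.
Proof.
move=> xy xz yz; rewrite -setUA cardsU1 cards2 yz !inE negb_or xy xz //.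
Qed.

Lemma cards3_neq (T : finType) (x y z : T) :
  #|[set x; y; z]| = 3 -> [/\ x != y, x != z & y != z].
Proof.
rewrite -setUA cardsU1 cards2 !inE negb_or.
by case: (x != y); case: (x != z); case: (y != z).
Qed.

Lemma card_set3_filter (T : finType) (P : pred T) (x y z : T) :
  x != y -> x != z -> y != z ->
  #|[set t in [set x; y; z] | P t]| = P x + P y + P z.
Proof.
move=> xy xz yz; rewrite -sum1dep_card big_mkcondr -setUA.
rewrite big_setU1 /= ?inE ?negb_or ?xy // big_setU1 /= ?inE // big_set1.
by case: (P x); case: (P y); case: (P z).
Qed.

Lemma set3_sub (T : finType) (x y z : T) (X : {set T}) :
  ([set x; y; z] \subset X) = [&& x \in X, y \in X & z \in X].
Proof. by rewrite !subUset !sub1set andbA. Qed.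

Lemma set3_eq (T : finType) (i j k a b c : T) :
  i != j -> i != k -> j != k ->
  ([set i; j; k] == [set a; b; c]) =
  [&& i \in [:: a; b; c], j \in [:: a; b; c] & k \in [:: a; b; c]].
Proof.
move=> ij ik jk.
have E x : (x \in [set a; b; c]) = (x \in [:: a; b; c]) by rewrite !inE orbA.
rewrite -!E -set3_sub; apply/eqP/idP => [->|sub]; first exact: subxx.
apply/eqP; rewrite eqEcard sub (cards3 ij ik jk) -setUA cardsU1 cards2.
by case: (_ \notin _); case: (_ != _).
Qed.

(** A computable form, so that finite checks reduce by evaluation. The vertices fall into pairs
    {0,1}, {2,5}, {3,4}; a nonedge is an outer pair {0,1} or {3,4} together with one vertex of the
    middle pair {2,5}. *)
Definition g26_nat (i j k : nat) : bool :=
  [&& i != j, i != k, j != k &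
   all (fun s : seq nat => ~~ [&& i \in s, j \in s & k \in s])
     [:: [:: 0; 1; 2]; [:: 0; 1; 5]; [:: 2; 3; 4]; [:: 3; 4; 5]]].

Lemma g26E i j k : g26 i j k = g26_nat i j k.
Proof.
rewrite /g26 /g26_nat !(inj_eq val_inj) inE.
case: (boolP (i != j)) => [ij|/negbNE/eqP->]; last first.
  by rewrite setUid cards2; case: (j != k).
case: (boolP (i != k)) => [ik|/negbNE/eqP->]; last first.
  by rewrite setUAC setUid cards2; case: (k != j).
case: (boolP (j != k)) => [jk|/negbNE/eqP->]; last first.
  by rewrite -setUA setUid cards2; case: (i != k).
rewrite cards3 //= !inE !set3_eq // !inE -!(inj_eq val_inj) /= !inordK //.
by rewrite !negb_or !andbT !andbA.
Qed.

Lemma g26_sym : sym3 g26.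
Proof.
split=> [x y z|x y z|x z]; rewrite /g26.
- by rewrite (setUC [set x]).
- by rewrite setUAC.
- by rewrite -/(g26 x x z) g26E /g26_nat eqxx.
Qed.

Lemma exactly_oneE a b c : exactly_one a b c =
  [|| [&& a, ~~ b & ~~ c], [&& ~~ a, b & ~~ c] | [&& ~~ a, ~~ b & c]].
Proof. by case: a; case: b; case: c. Qed.

Lemma exists_covering_set (V : finType) (h : V -> V -> V -> bool) (S : {set V}) :
  sym3 h ->
  (forall x y, x \in S -> y \in S -> x != y -> exists w, h x y w) ->
  exists X : {set V}, [/\ S \subset X, #|X| <= #|S| + 'C(#|S|, 2) &
    forall x y, x \in S -> y \in S -> x != y -> exists2 w, w \in X & h x y w].
Proof.
move=> sh cS; case: (set_0Vmem S) => [->|[v0 _]].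
  by exists set0; split; rewrite ?cards0 // => x y; rewrite inE.
(* Choosing the witness per unordered pair keeps the count at a binomial coefficient. *)
pose W (e : {set V}) := odflt v0 [pick w | [exists x in e, exists y in e, h x y w]].
pose P := [set e : {set V} | e \subset S & #|e| == 2].
exists (S :|: W @: P); split; first exact: subsetUl.
  apply: leq_trans (leq_card_setU _ _) _.
  by rewrite leq_add2l -cards_draws leq_imset_card.
move=> x y xS yS xy; exists (W [set x; y]).
  rewrite inE imset_f ?orbT // inE cards2 xy eqxx andbT.
  by rewrite subUset !sub1set xS yS.
have [w0 hw0] := cS x y xS yS xy.
rewrite /W; case: pickP => [w|/(_ w0)] /=.
  case/existsP=> x' /andP[+ /existsP[y' /andP[]]]; rewrite !inE.
  by move=> /orP[]/eqP-> /orP[]/eqP->; rewrite ?(sym3i sh) // (sym3l sh).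
move=> /negbT /existsP[]; exists x; rewrite !inE eqxx /=.
by apply/existsP; exists y; rewrite !inE eqxx orbT.
Qed.

(** * From [Mfree] to [good] *)

Definition triple (V : finType) (H : {set {set V}}) (x y z : V) : bool :=
  [set x; y; z] \in H.

Lemma triple_sym (V : finType) (H : {set {set V}}) : is3graph H -> sym3 (triple H).
Proof.
move=> H3; split=> [x y z|x y z|x z]; rewrite /triple.
- by rewrite (setUC [set x]).
- by rewrite setUAC.
- by apply/negP => /H3; rewrite setUid cards2; case: (_ != _).
Qed.

(** The minimum that defines [tau] starts from the default [#|V|], which therefore has to exceed 1
    as well. *)
Lemma tau_gt1 (V : finType) (H : {set {set V}}) : 1 < #|V| ->
  (forall T : {set V}, #|T| <= 1 -> exists2 e, e \in H & T :&: e = set0) ->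
  1 < tau H.
Proof.
move=> V2 HT; rewrite /tau.
apply: (big_ind (fun k => 1 < k)) => [//|a b a1 b1|T /forall_inP TH].
  by rewrite leq_min a1.
rewrite ltnNge; apply/negP => /HT [e eH E]; by have := TH e eH; rewrite E eqxx.
Qed.

Lemma contained_restriction (V : finType) (H : {set {set V}}) (X : {set V}) :
  contained [set e : {set 'I_#|X|} | enum_val @: e \in H] H.
Proof. by exists enum_val; split=> [|e]; [exact: enum_val_inj | rewrite inE]. Qed.

Lemma G1_coloring (U : finType) (F : {set {set U}}) n : contained F (G1 n) ->
  exists c, coloring exactly_one (triple F) [set: U] c.
Proof.
case=> f [fi fF]; exists (fun x => (f x < n %/ 3)%N) => x y z _ _ _ /fF.
rewrite inE imset_set3 => /andP[/eqP/cards3_neq[xy xz yz] /eqP E].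
by rewrite /exactly_one -(card_set3_filter (fun t : 'I_n => t < n %/ 3) xy xz yz) E.
Qed.

Lemma G26_coloring (U W : finType) (F : {set {set U}}) (p : W -> 'I_6) :
  contained F (blowupE p G26) -> exists c, coloring g26 (triple F) [set: U] c.
Proof.
case=> f [fi fF]; exists (p \o f) => x y z _ _ _ /fF.
by rewrite inE => /andP[_]; rewrite !imset_set3.
Qed.

Lemma wlog_sorted3 (n : nat) (P : nat -> nat -> nat -> Prop) :
  (forall i j k, P i j k -> P j i k) -> (forall i j k, P i j k -> P i k j) ->
  (forall i j k, i < j -> j < k -> k < n -> P i j k) ->
  forall i j k, i < n -> j < n -> k < n -> i != j -> i != k -> j != k -> P i j k.
Proof.
move=> Pl Pr Ps i j k i_n j_n k_n.
case: (ltngtP i j) => // ij _; case: (ltngtP i k) => // ik _;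
  case: (ltngtP j k) => // jk _; try lia.
- exact: Ps.
- by apply: Pr; apply: Ps.
- by apply: Pr; apply: Pl; apply: Ps.
- by apply: Pl; apply: Ps.
- by apply: Pl; apply: Pr; apply: Ps.
- by apply: (Pl); apply: Pr; apply: Pl; apply: Ps.
Qed.

Lemma restriction_core (V : finType) (H : {set {set V}}) (S X : {set V}) l :
  is3graph H -> S \subset X -> #|S| = l.+1 -> #|X| <= l.+1 + 'C(l.+1, 2) ->
  (forall x y, x \in S -> y \in S -> x != y ->
    exists2 w, w \in X & triple H x y w) ->
  let F := [set e : {set 'I_#|X|} | enum_val @: e \in H] in
  let S' := [set i : 'I_#|X| | enum_val i \in S] in
  inK l F /\ isCore l F S'.
Proof.
move=> H3 SX Sl Xl cS F S'; have coreS : isCore l F S'.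
  split.
    rewrite -Sl -(card_imset _ (@enum_val_inj _ (mem X))); apply: eq_card => x.
    apply/imsetP/idP => [[i + ->]|xS]; first by rewrite inE.
    have xX := subsetP SX x xS; exists (enum_rank_in xX x).
      by rewrite inE enum_rankK_in.
    by rewrite enum_rankK_in.
  move=> i j; rewrite !inE => iS jS ij.
  have [|w wX hw] := cS _ _ iS jS; first by rewrite (inj_eq enum_val_inj).
  exists [set i; j; enum_rank_in wX w]; last by rewrite !inE !eqxx orbT.
  by rewrite inE imset_set3 enum_rankK_in.
split=> //; split; last by split=> //; exists S'.
by move=> e; rewrite inE => /H3; rewrite card_imset //; apply: enum_val_inj.
Qed.

Lemma Mfree_good (V : finType) (H : {set {set V}}) :
  is3graph H -> Mfree H -> good (triple H).
Proof.
move=> H3 [HK5 [HM2 HM3]]; have sh := triple_sym H3; split=> //.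
- move=> a b c d e abd abe acd ace bcd bce ade bde cde; apply: HK5.
  have U : uniq [:: a; b; c; d; e].
    have [? ? ?] := sym3_neq sh abd; have [? ? ?] := sym3_neq sh ace.
    have [? ? ?] := sym3_neq sh bcd; have [? ? ?] := sym3_neq sh cde.
    have [? ? ?] := sym3_neq sh bce.
    rewrite /= !inE !negb_or; by do !(apply/andP; split).
  exists (fun i : 'I_5 => nth a [:: a; b; c; d; e] i); split.
    by move=> i j /eqP; rewrite nth_uniq // => /eqP /val_inj.
  move=> f; rewrite inE => /andP[/eqP/cards3P[i [j [k [ij ik jk ->]]]]].
  rewrite set3_eq // !inE -!(inj_eq val_inj) /= !inordK // imset_set3.
  apply: (@wlog_sorted3 5 (fun i j k =>
    ~~ [&& [|| i == 0, i == 1 | i == 2], [|| j == 0, j == 1 | j == 2] &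
           [|| k == 0, k == 1 | k == 2]] ->
    triple H (nth a [:: a; b; c; d; e] i) (nth a [:: a; b; c; d; e] j)
      (nth a [:: a; b; c; d; e] k))) => //.
  + by move=> {i j k ij ik jk} i j k IH; rewrite (sym3l sh) andbCA.
  + by move=> {i j k ij ik jk} i j k IH; rewrite (sym3r sh) (andbC [|| k == 0, _ | _]).
  by move=> [|[|[|[|[|?]]]]] [|[|[|[|[|?]]]]] [|[|[|[|[|?]]]]].
- move=> S S7 cS.
  have [X [SX X28 cX]] := exists_covering_set sh cS; rewrite S7 in X28.
  apply: NNPP => nt.
  have [KF coreF] := @restriction_core V H S X 6 H3 SX S7 X28 cX.
  apply: (HM2 _ _ _ (contained_restriction H X)); split=> //.
  exists [set i : 'I_#|X| | enum_val i \in S]; split=> //.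
  have X7 : 7 <= #|X| by rewrite -S7 subset_leq_card.
  apply: tau_gt1 => [|T T1]; first by rewrite card_ord; lia.
  apply: NNPP => noe; apply: nt.
  have hitT x y z : x \in S -> y \in S -> z \in S -> triple H x y z ->
      exists i, i \in T /\ enum_val i \in [:: x; y; z].
    move=> xS yS zS hxyz; apply: NNPP => nT; apply: noe.
    have rX u : u \in S -> {i : 'I_#|X| | enum_val i = u}.
      by move=> /(subsetP SX) uX; exists (enum_rank_in uX u); rewrite enum_rankK_in.
    have [i Ei] := rX x xS; have [j Ej] := rX y yS; have [k Ek] := rX z zS.
    exists [set i; j; k].
      rewrite !inE imset_set3 Ei Ej Ek; apply/andP; split=> //.
      by rewrite set3_sub !inE Ei Ej Ek xS yS.
    apply/setP => t; rewrite !inE; apply/negP => /andP[tT tijk]; apply: nT.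
    exists t; split=> //; rewrite -Ei -Ej -Ek !inE !(inj_eq enum_val_inj).
    by rewrite orbA.
  (* An empty transversal means that [S] spans no triple, and then any vertex of [S] is an apex. *)
  case: (set_0Vmem T) => [T0|[t0 t0T]].
    have [v0 v0S] : exists x, x \in S by apply/set0Pn; rewrite -card_gt0 S7.
    exists v0 => x y z xS yS zS /(hitT _ _ _ xS yS zS)[i []].
    by rewrite T0 inE.
  exists (enum_val t0) => x y z xS yS zS /(hitT _ _ _ xS yS zS)[i [iT]].
  suff -> : i = t0 by [].
  by apply/eqP; move/card_le1_eqP: T1 => /(_ _ _ iT t0T) ->.
- move=> S X SX S6 X21 cX.
  have [KF coreF] := @restriction_core V H S X 5 H3 SX S6 X21 cX.
  have [x0 x0X] : exists x, x \in X.
    by apply/set0Pn; rewrite -card_gt0 (leq_trans _ (subset_leq_card SX)) ?S6.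
  set F := [set e : {set 'I_#|X|} | enum_val @: e \in H] in KF coreF.
  (* [F] has a 6-core; not being in M_3, it embeds into some [G1 n] or a blowup of [G26], and the
     parts of the host serve as colours. *)
  have : ~ ((forall n, 1 <= n -> ~ contained F (G1 n)) /\
      (forall n (p : 'I_n -> 'I_6), 6 <= n -> maxG26blowup p ->
        ~ contained F (blowupE p G26))).
    by move=> N; apply: (HM3 _ _ (conj KF N) (contained_restriction H X)).
  case/not_and_or=> [/not_all_ex_not[n]|/not_all_ex_not[n]].
  + move=> N; have [_ /NNPP/G1_coloring[c Hc]] := imply_to_and _ _ N.
    left; exists (c \o enum_rank_in x0X) => x y z xX yX zX hxyz; apply: Hc => //.
    by rewrite /triple inE imset_set3 !enum_rankK_in.
  + move=> /not_all_ex_not[p] N; have [_ N'] := imply_to_and _ _ N.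
    have [_ /NNPP/G26_coloring[c Hc]] := imply_to_and _ _ N'.
    right; exists (c \o enum_rank_in x0X) => x y z xX yX zX hxyz; apply: Hc => //.
    by rewrite /triple inE imset_set3 !enum_rankK_in.
Qed.

(** * Symmetrized 3-graphs *)

Lemma subset_between (T : finType) (A B : {set T}) k :
  A \subset B -> #|A| <= k -> k <= #|B| ->
  exists C : {set T}, [/\ A \subset C, C \subset B & #|C| = k].
Proof.
move=> AB; elim: k => [|k IH] Ak kB.
  by exists A; split=> //; apply/eqP; rewrite -leqn0.
move: Ak; rewrite leq_eqVlt => /orP[/eqP Ak|Ak]; first by exists A.
have [C [AC CB Ck]] := IH Ak (ltnW kB).
have [x xB xC] : exists2 x, x \in B & x \notin C.
  have /subsetPn[x xB xC] : ~~ (B \subset C) by apply: contraTN kB => /subset_leq_card; lia.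
  by exists x.
exists (x |: C); split; first exact: subset_trans AC (subsetUr _ _).
  by rewrite subUset sub1set xB.
by rewrite cardsU1 xC Ck.
Qed.

(** Two disjoint edges suffice. If two edges meet only in [b], an edge avoiding [b] meets them and
    adds at most 2 to their 5 vertices. If any two edges share at least 2 vertices, three edges that
    each avoid one vertex of [e0] add at most 1 each to its 3. *)
Lemma small_nonstar (T : finType) (E : {set {set T}}) :
  is3graph E -> E != set0 -> (forall t, exists2 e, e \in E & t \notin e) ->
  exists2 U : {set T}, #|U| <= 7 &
    forall t, exists e, [/\ e \in E, e \subset U & t \notin e].
Proof.
move=> E3 /set0Pn[e0 e0E] nstar.
have addc (Y e f : {set T}) : e \in E -> f \subset Y -> #|Y :|: e| <= #|Y| + (3 - #|f :&: e|).
  move=> /E3 eE fY; have := cardsUI Y e; have := subset_leq_card (setSI e fY); lia.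
case: (classic (exists e f, [/\ e \in E, f \in E & #|e :&: f| = 0])) => [[e [f [eE fE ef]]]|N0].
  exists (e :|: f); first by rewrite cardsU (E3 e) // (E3 f) // ef.
  move=> t; case: (boolP (t \in e)) => te; last by exists e; rewrite subsetUl.
  exists f; rewrite subsetUr; split=> //; apply/negP => tf.
  by move/cards0_eq/setP/(_ t): ef; rewrite !inE te tf.
have int e f : e \in E -> f \in E -> 0 < #|e :&: f|.
  by move=> eE fE; rewrite lt0n; apply/eqP => ef; apply: N0; exists e, f.
case: (classic (exists e f, [/\ e \in E, f \in E & #|e :&: f| = 1])) => [[e [f [eE fE /eqP/cards1P[b ef]]]]|N1].
  have [g gE bg] := nstar b; exists (e :|: f :|: g).
    have := addc (e :|: f) g e gE (subsetUl _ _); have := int e g eE gE.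
    have -> : #|e :|: f| = 5 by rewrite cardsU (E3 e) // (E3 f) // ef cards1.
    lia.
  move=> t; case: (boolP (t \in e)) => te; last by exists e; rewrite -setUA subsetUl.
  case: (boolP (t \in f)) => tf; last by exists f; rewrite setUAC subsetUr.
  exists g; rewrite subsetUr; split=> //.
  have : t \in e :&: f by rewrite inE te.
  by rewrite ef inE => /eqP->.
have int2 e f : e \in E -> f \in E -> 1 < #|e :&: f|.
  move=> eE fE; have := int e f eE fE; rewrite leq_eqVlt => /orP[/eqP ef|//].
  by case: N1; exists e, f.
have [a [b [c [ab ac bc e0abc]]]] := cards3P (E3 _ e0E).
have [fa aE afa] := nstar a; have [fb bE bfb] := nstar b; have [fc cE cfc] := nstar c.
exists (e0 :|: fa :|: fb :|: fc).
  have := addc (e0 :|: fa :|: fb) fc e0 cE; have := addc (e0 :|: fa) fb e0 bE.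
  have := addc e0 fa e0 aE (subxx _); rewrite -setUA !subsetUl (E3 _ e0E).
  have := int2 e0 fa e0E aE; have := int2 e0 fb e0E bE; have := int2 e0 fc e0E cE.
  rewrite setUA => ? ? ? ? /(_ isT) ? /(_ isT); lia.
move=> t; case: (boolP (t \in e0)) => te; last by exists e0; rewrite -!setUA subsetUl.
move: te; rewrite e0abc !inE -orbA => /or3P[]/eqP->.
- exists fa; split=> //; apply/subsetP => x; rewrite !inE => ->; by rewrite ?orbT.
- exists fb; split=> //; apply/subsetP => x; rewrite !inE => ->; by rewrite ?orbT.
- exists fc; split=> //; apply/subsetP => x; rewrite !inE => ->; by rewrite ?orbT.
Qed.

Lemma coloring_of_indices (V : finType) (h : V -> V -> V -> bool) (s : seq V)
    (kappa : seq nat) (v0 : V) : sym3 h -> uniq s -> all (gtn 6) kappa ->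
  (forall i j k, i < j -> j < k -> k < size s ->
    h (nth v0 s i) (nth v0 s j) (nth v0 s k) ->
    g26_nat (nth 0 kappa i) (nth 0 kappa j) (nth 0 kappa k)) ->
  coloring g26 h [set x in s] (fun x => inord (nth 0 kappa (index x s))).
Proof.
move=> sh Us k6 H x y z; rewrite !inE => xs ys zs hxyz.
have [xy xz yz] := sym3_neq sh hxyz.
have lt6 i : nth 0 kappa i < 6.
  by case: (ltnP i (size kappa)) => ik; [apply: (all_nthP 0 k6) | rewrite nth_default].
pose c i : 'I_6 := inord (nth 0 kappa i).
rewrite -/(c _) -/(c (index y s)) -/(c (index z s)).
have idx u v : u \in s -> v \in s -> u != v -> index u s != index v s.
  by move=> us vs; apply: contraNneq => E; rewrite -(nth_index v0 us) E nth_index.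
have := @wlog_sorted3 (size s) (fun i j k => h (nth v0 s i) (nth v0 s j) (nth v0 s k) ->
    g26 (c i) (c j) (c k)); move=> /(_ _ _ _ (index x s) (index y s) (index z s)).
rewrite !nth_index // !index_mem => -> //; rewrite ?idx //.
- by move=> i j k IH; rewrite (sym3l sh) (sym3l g26_sym).
- by move=> i j k IH; rewrite (sym3r sh) (sym3r g26_sym).
by move=> i j k ij jk ks /(H _ _ _ ij jk ks); rewrite g26E /c !inordK.
Qed.

(** On five vertices at least two triples are missing, as ten or nine triples would contain K5 minus
    an edge; two nonedges are enough room to map into [G26]. *)
Lemma coloring_on5 (V : finType) (h : V -> V -> V -> bool) (S : {set V}) :
  good h -> #|S| <= 5 -> exists c, coloring g26 h S c.
Proof.
move=> gh; have sh := good_sym gh.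
rewrite leq_eqVlt => /orP[/eqP S5|S4]; last first.
  case: (set_0Vmem S) => [->|[v0 _]].
    by exists (fun=> ord0) => x y z; rewrite inE.
  have -> : S = [set x in enum S] by apply/setP => x; rewrite inE mem_enum.
  (* The vertices 0, 2, 3, 5 of [G26] span all four triples, so any relation on four vertices maps
     there. *)
  eexists; apply: (@coloring_of_indices _ h _ [:: 0; 2; 3; 5] v0) => //.
    exact: enum_uniq.
  rewrite -cardE => i j k ij jk kS _; have {kS} : k < 4 by lia.
  by move: i j k ij jk => [|[|[|[|?]]]] [|[|[|[|?]]]] [|[|[|[|?]]]].
case: (classic (exists a b c, [/\ a \in S, b \in S & c \in S] /\
    [/\ a != b, a != c & b != c] /\ ~~ h a b c)); last first.
  move=> N; have all3 a b c : a \in S -> b \in S -> c \in S -> a != b -> a != c -> b != c -> h a b c.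
    by move=> *; apply/negPn/negP => nh; apply: N; exists a, b, c.
  have := enum_uniq (mem S); have := mem_enum (mem S); move: S5; rewrite cardE.
  case: (enum S) => [|a [|b [|c [|d [|e []]]]]] //= _ mS.
  rewrite !inE !negb_or -!andbA => /and5P[ab ac ad ae /and5P[bc bd be cd /and3P[ce de _]]].
  case: (good_K5 gh (a := a) (b := b) (c := c) (d := d) (e := e)); apply: all3 => //;
    by rewrite -mS !inE eqxx ?orbT.
case=> a [b [c [[aS bS cS] [[ab ac bc] nabc]]]].
have /cards2P[d [e [de DE]]] : #|S :\: [set a; b; c]| == 2.
  rewrite cardsD (setIidPr _) ?cards3 ?S5 //.
  by rewrite set3_sub aS bS.
have : d \in S :\: [set a; b; c] by rewrite DE !inE eqxx.
have : e \in S :\: [set a; b; c] by rewrite DE !inE eqxx orbT.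
rewrite !inE !negb_or -!andbA => /and4P[ea eb ec eS] /and4P[da db dc dS].
have SE : S = [set x in [:: a; b; c; d; e]].
  apply/setP => x; rewrite !inE; apply/idP/idP => [xS|].
    have /setP/(_ x) := DE; rewrite !inE xS andbT.
    by case: (x == a); case: (x == b); case: (x == c) => //= <-.
  by move=> /or4P[/eqP->|/eqP->|/eqP->|/orP[]/eqP->].
have Us : uniq [:: a; b; c; d; e].
  by rewrite /= !inE !negb_or ab ac bc de (eq_sym a) da (eq_sym a) ea
    (eq_sym b) db (eq_sym b) eb (eq_sym c) dc (eq_sym c) ec.
pose s := [:: a; b; c; d; e]; pose ht i j k := h (nth a s i) (nth a s j) (nth a s k).
(* [kappa] must send to edges all increasing index triples except the two known to be missing. *)
have fin i0 j0 k0 kappa : ~~ ht i0 j0 k0 -> all (gtn 6) kappa ->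
    all (fun t => [|| t == (0, 1, 2), t == (i0, j0, k0) |
           g26_nat (nth 0 kappa t.1.1) (nth 0 kappa t.1.2) (nth 0 kappa t.2)])
      [:: (0, 1, 2); (0, 1, 3); (0, 1, 4); (0, 2, 3); (0, 2, 4);
          (0, 3, 4); (1, 2, 3); (1, 2, 4); (1, 3, 4); (2, 3, 4)] ->
    exists c0, coloring g26 h S c0.
  move=> n0 k6 /allP H; rewrite SE; eexists.
  apply: (@coloring_of_indices _ h s kappa a sh Us k6) => i j k ij jk k5.
  rewrite -/(ht i j k) => hijk; move: (H (i, j, k)) hijk => /=.
  have -> : (i, j, k) \in [:: (0, 1, 2); (0, 1, 3); (0, 1, 4); (0, 2, 3); (0, 2, 4);
          (0, 3, 4); (1, 2, 3); (1, 2, 4); (1, 3, 4); (2, 3, 4)].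
    by move: i j k ij jk k5 {H} => [|[|[|[|[|?]]]]] [|[|[|[|[|?]]]]] [|[|[|[|[|?]]]]].
  move=> /(_ isT) /or3P[/eqP[-> -> ->]|/eqP[-> -> ->]|//] h1; last by rewrite h1 in n0.
  by move: nabc; rewrite [h a b c]h1.
(* Two missing triples meet in one or two vertices, and both patterns of two
   non-edges occur in a vertex-deleted copy of G26. *)
case: (boolP (ht 0 1 3)) => [abd|n]; last exact: (fin _ _ _ [:: 0; 1; 2; 5; 3] n isT isT).
case: (boolP (ht 0 1 4)) => [abe|n]; last exact: (fin _ _ _ [:: 0; 1; 2; 3; 5] n isT isT).
case: (boolP (ht 0 2 3)) => [acd|n]; last exact: (fin _ _ _ [:: 0; 2; 1; 5; 3] n isT isT).
case: (boolP (ht 0 2 4)) => [ace|n]; last exact: (fin _ _ _ [:: 0; 2; 1; 3; 5] n isT isT).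
case: (boolP (ht 1 2 3)) => [bcd|n]; last exact: (fin _ _ _ [:: 2; 0; 1; 5; 3] n isT isT).
case: (boolP (ht 1 2 4)) => [bce|n]; last exact: (fin _ _ _ [:: 2; 0; 1; 3; 5] n isT isT).
case: (boolP (ht 0 3 4)) => [ade|n]; last exact: (fin _ _ _ [:: 5; 0; 1; 3; 4] n isT isT).
case: (boolP (ht 1 3 4)) => [bde|n]; last exact: (fin _ _ _ [:: 0; 5; 1; 3; 4] n isT isT).
case: (boolP (ht 2 3 4)) => [cde|n]; last exact: (fin _ _ _ [:: 0; 1; 5; 3; 4] n isT isT).
by case: (good_K5 gh abd abe acd ace bcd bce ade bde cde).
Qed.

Definition same_link (V : finType) (h : V -> V -> V -> bool) (x y : V) : bool :=
  [forall a, forall b, h x a b == h y a b].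

Lemma same_linkP (V : finType) (h : V -> V -> V -> bool) x y :
  reflect (forall a b, h x a b = h y a b) (same_link h x y).
Proof.
apply: (iffP forallP) => [H a b|H a]; first by apply/eqP; move/forallP: (H a).
by apply/forallP => b; rewrite H.
Qed.

Definition symmetrized (V : finType) (h : V -> V -> V -> bool) : Prop :=
  forall x y, (forall w, ~~ h x y w) -> same_link h x y.

(** M_2 speaks of exactly seven core vertices. A failure to be a star is already visible on at most
    seven vertices by [small_nonstar], and these extend to a 7-subset of [S], which is again a
    core. *)
Lemma star_of_core (V : finType) (h : V -> V -> V -> bool) (S : {set V}) :
  good h -> 7 <= #|S| ->
  (forall x y, x \in S -> y \in S -> x != y -> exists w, h x y w) ->
  exists t, forall x y z, x \in S -> y \in S -> z \in S -> h x y z ->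
    t \in [:: x; y; z].
Proof.
move=> gh S7 cS; have sh := good_sym gh; apply: NNPP => nt.
pose E := [set e : {set V} | [exists x in S, exists y in S, exists z in S,
   h x y z && (e == [set x; y; z])]].
have EP e : reflect (exists x y z, [/\ x \in S, y \in S & z \in S] /\
    h x y z /\ e = [set x; y; z]) (e \in E).
  apply: (iffP idP).
    rewrite inE => /existsP[x /andP[xS /existsP[y /andP[yS /existsP[z /andP[zS /andP[hz /eqP->]]]]]]].
    by exists x, y, z.
  case=> x [y [z [[xS yS zS] [hz ->]]]]; rewrite inE.
  apply/existsP; exists x; rewrite xS; apply/existsP; exists y; rewrite yS.
  by apply/existsP; exists z; rewrite zS hz eqxx.
have nstar t : exists2 e, e \in E & t \notin e.
  apply: NNPP => N; apply: nt; exists t => x y z xS yS zS hz.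
  apply/negPn/negP => tN; apply: N; exists [set x; y; z].
    by apply/EP; exists x, y, z.
  by move: tN; rewrite !inE orbA.
have [v0 _] : exists x, x \in S by apply/set0Pn; rewrite -card_gt0; lia.
have [||U U7 HU] := @small_nonstar _ E _ _ nstar.
- move=> e /EP[x [y [z [_ [/(sym3_neq sh)[? ? ?] ->]]]]]; exact: cards3.
- by apply/set0Pn; have [e eE _] := nstar v0; exists e.
have [|C [UC CS C7]] := @subset_between _ (U :&: S) S 7 (subsetIr _ _) _ S7.
  by apply: leq_trans U7; rewrite subset_leq_card // subsetIl.
have [|t Ht] := good_core7 gh C7.
  by move=> x y /(subsetP CS) xS /(subsetP CS) yS; apply: cS.
have [e [/EP[x [y [z [[xS yS zS] [hz ->]]]]]]] := HU t.
rewrite set3_sub => /and3P[xU yU zU]; apply/negP/negPn.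
have inC u : u \in U -> u \in S -> u \in C.
  by move=> uU uS; apply: (subsetP UC); rewrite inE uU.
by have := Ht x y z (inC _ xU xS) (inC _ yU yS) (inC _ zU zS) hz; rewrite !inE orbA.
Qed.

Lemma symmetrized_colorable (V : finType) (h : V -> V -> V -> bool) :
  good h -> symmetrized h -> colorable h [set: V].
Proof.
move=> gh sy; have sh := good_sym gh.
(* [pick] depends only on the extension of its predicate, so twins get the same representative. *)
pose rep x := odflt x [pick y | same_link h x y].
have repl x : same_link h x (rep x).
  by rewrite /rep; case: pickP => //= _; apply/same_linkP.
have rep_eq x y : same_link h x y -> rep x = rep y.
  move=> /same_linkP xy; rewrite /rep.
  have E : same_link h x =1 same_link h y.
    by move=> z; apply/same_linkP/same_linkP => H a b; rewrite -H ?xy.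
  rewrite (eq_pick E); case: pickP => //= /(_ y) /negbT/negP[]; exact/same_linkP.
have hrep x y z : h x y z = h (rep x) (rep y) (rep z).
  rewrite (same_linkP _ _ _ (repl x)) (sym3l sh) (same_linkP _ _ _ (repl y)).
  rewrite (sym3r sh) (sym3l sh) (same_linkP _ _ _ (repl z)).
  by rewrite (sym3r sh) (sym3l sh) (sym3r sh).
pose S := rep @: V.
have repS x : rep x \in S by exact: imset_f.
have cS x y : x \in S -> y \in S -> x != y -> exists w, h x y w.
  move=> /imsetP[x' _ ->] /imsetP[y' _ ->] xy; apply: NNPP => N.
  case/eqP: xy; apply: rep_eq; apply: sy => w; apply/negP => hw; apply: N.
  by exists (rep w); rewrite -hrep.
case: (ltngtP #|S| 6) => S6.
- have [c Hc] := coloring_on5 gh (S6 : #|S| <= 5).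
  by right; exists (c \o rep) => x y z _ _ _; rewrite hrep; apply: Hc.
- have [t Ht] := star_of_core gh S6 cS.
  left; exists (fun x => rep x == t) => x y z _ _ _; rewrite hrep => hz.
  have := Ht _ _ _ (repS x) (repS y) (repS z) hz; have [] := sym3_neq sh hz.
  rewrite exactly_oneE !inE !(eq_sym t) => xy xz yz.
  by case/or3P=> /eqP <-; rewrite eqxx ?(eq_sym (rep y) (rep x)) ?(eq_sym (rep z)) ?(negbTE xy) ?(negbTE xz) ?(negbTE yz) ?orbT.
- have [X [SX X21 cX]] := exists_covering_set sh cS; rewrite S6 in X21.
  have subX x := subsetP SX _ (repS x).
  have [[c Hc]|[c Hc]] := good_core6 gh SX S6 X21 cX; [left|right];
    by exists (c \o rep) => x y z _ _ _; rewrite hrep; apply: Hc.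
Qed.

(** * Symmetrization *)

(* Ordered pairs are counted: this is twice the usual degree inside W. *)
Definition odeg (V : finType) (h : V -> V -> V -> bool) (W : {set V}) (x : V) : nat :=
  \sum_(y in W) \sum_(z in W) h x y z.

(** Six times the number of edges; this turns the density 2/27 into 4/9. *)
Definition oedges (V : finType) (h : V -> V -> V -> bool) : nat :=
  \sum_x odeg h [set: V] x.

(** Second component of the potential that makes the cloning process terminate. *)
Definition linkpairs (V : finType) (h : V -> V -> V -> bool) : nat :=
  \sum_x \sum_y same_link h x y.

Definition clone (V : finType) (u v x : V) : V := if x == v then u else x.

Lemma sum_setT (V : finType) (F : V -> nat) : \sum_(y in [set: V]) F y = \sum_y F y.
Proof. by apply: eq_bigl => y; rewrite inE. Qed.

Lemma odegT (V : finType) (h : V -> V -> V -> bool) x :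
  odeg h [set: V] x = \sum_y \sum_z h x y z.
Proof. by rewrite /odeg sum_setT; apply: eq_bigr => y _; rewrite sum_setT. Qed.

Lemma oedges_split (V : finType) (h : V -> V -> V -> bool) v : sym3 h ->
  oedges h = \sum_(x | x != v) \sum_(y | y != v) \sum_(z | z != v) h x y z
             + 3 * odeg h [set: V] v.
Proof.
move=> sh.
have hiv x : h x v v = false by rewrite (sym3l sh) (sym3r sh) (sym3i sh).
have drop (F : V -> nat) : F v = 0 -> \sum_(x | x != v) F x = \sum_x F x.
  by move=> Fv; rewrite [RHS](bigD1 v) //= Fv.
have E1 : \sum_(x | x != v) \sum_z (h x v z : nat) = odeg h [set: V] v.
  rewrite odegT drop; last by rewrite big1 // => z _; rewrite (sym3i sh).
  by apply: eq_bigr => x _; apply: eq_bigr => z _; rewrite (sym3l sh).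
have E2 : \sum_(x | x != v) \sum_(y | y != v) (h x y v : nat) = odeg h [set: V] v.
  rewrite odegT drop; last by rewrite big1 // => z _; rewrite (sym3r sh) (sym3i sh).
  apply: eq_bigr => x _; rewrite drop; last by rewrite hiv.
  by apply: eq_bigr => y _; rewrite (sym3r sh) (sym3l sh).
rewrite /oedges (bigD1 v) //=.
have -> : \sum_(x | x != v) odeg h [set: V] x = \sum_(x | x != v) (\sum_z (h x v z : nat)
    + (\sum_(y | y != v) (h x y v : nat) + \sum_(y | y != v) \sum_(z | z != v) h x y z)).
  apply: eq_bigr => x _; rewrite odegT (bigD1 v) //=; congr (_ + _).
  by rewrite -big_split; apply: eq_bigr => y _; rewrite (bigD1 v).
by rewrite big_split big_split /= E1 E2; lia.
Qed.

(** The summand 1 corrects for the pair formed by [v] twice, which lies in both the row and the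
    column of [v]. *)
Lemma linkpairs_split (V : finType) (h : V -> V -> V -> bool) v :
  linkpairs h + 1 = \sum_(x | x != v) \sum_(y | y != v) same_link h x y
                    + 2 * \sum_y same_link h v y.
Proof.
have sC x y : same_link h x y = same_link h y x.
  by apply/same_linkP/same_linkP => H a b; rewrite H.
rewrite /linkpairs (bigD1 v) //=.
have -> : \sum_(x | x != v) \sum_y (same_link h x y : nat) =
    \sum_(x | x != v) (same_link h x v : nat) +
    \sum_(x | x != v) \sum_(y | y != v) same_link h x y.
  by rewrite -big_split; apply: eq_bigr => x _; rewrite (bigD1 v).
have E : \sum_(x | x != v) (same_link h x v : nat) + 1 = \sum_y same_link h v y.
  rewrite [RHS](bigD1 v) //= addnC; congr (_ + _); first by have -> : same_link h v v by apply/same_linkP.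
  by apply: eq_bigr => x _; rewrite sC.
lia.
Qed.

Lemma leq_bool (a b : bool) : (a -> b) -> a <= b.
Proof. by case: a; case: b => // /(_ isT). Qed.

Lemma sum_bool_le (I : finType) (P : pred I) (F : I -> bool) :
  \sum_(i | P i) F i <= #|I|.
Proof.
rewrite -sum1_card big_mkcond; apply: leq_sum => i _.
by case: (P i); case: (F i).
Qed.

Lemma sum_const_le (I : finType) (P : pred I) (F : I -> nat) m :
  (forall i, P i -> F i <= m) -> \sum_(i | P i) F i <= #|I| * m.
Proof.
move=> Fm; rewrite -sum_nat_const big_mkcond; apply: leq_sum => i _.
by case: ifP => // /Fm.
Qed.

(** No triple contains both [u] and [v], so substituting [u] for [v] inside the link of [u] changes
    nothing. *)
Lemma clone_odeg (V : finType) (h : V -> V -> V -> bool) u v : sym3 h ->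
  (forall w, ~~ h u v w) ->
  odeg (fun x y z => h (clone u v x) (clone u v y) (clone u v z)) [set: V] v =
  odeg h [set: V] u.
Proof.
move=> sh nuv; rewrite !odegT; apply: eq_bigr => y _; apply: eq_bigr => z _.
rewrite {1}/clone eqxx /clone.
case: (eqVneq y v) => [->|_]; first by rewrite (sym3i sh) (negbTE (nuv z)).
case: (eqVneq z v) => [->|//].
by rewrite (sym3r sh) (sym3i sh) (sym3r sh) (negbTE (nuv y)).
Qed.

Lemma clone_oedges (V : finType) (h : V -> V -> V -> bool) u v : sym3 h ->
  (forall w, ~~ h u v w) ->
  oedges (fun x y z => h (clone u v x) (clone u v y) (clone u v z)) +
    3 * odeg h [set: V] v = oedges h + 3 * odeg h [set: V] u.
Proof.
move=> sh nuv; rewrite (oedges_split v (sym3_pullback (clone u v) sh)) (oedges_split v sh).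
rewrite clone_odeg // addnAC; congr (_ + _ + _).
apply: eq_bigr => x xv; apply: eq_bigr => y yv; apply: eq_bigr => z zv.
by rewrite /clone (negbTE xv) (negbTE yv) (negbTE zv).
Qed.

(** Equal links away from [v] stay equal, and the new class of [v] contains the old class of [u] and
    [v] itself. *)
Lemma clone_linkpairs (V : finType) (h : V -> V -> V -> bool) u v :
  ~~ same_link h u v ->
  \sum_y same_link h v y <= \sum_y same_link h u y ->
  linkpairs h <
  linkpairs (fun x y z => h (clone u v x) (clone u v y) (clone u v z)).
Proof.
move=> nuv Cuv; set h' := fun x y z => _.
have off : \sum_(x | x != v) \sum_(y | y != v) same_link h x y <=
    \sum_(x | x != v) \sum_(y | y != v) same_link h' x y.
  apply: leq_sum => x xv; apply: leq_sum => y yv; apply: leq_bool.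
  move=> /same_linkP H; apply/same_linkP => a b.
  by rewrite /h' /(clone u v x) /(clone u v y) (negbTE xv) (negbTE yv).
have Cv : \sum_y same_link h u y + 1 <= \sum_y same_link h' v y.
  rewrite (bigD1 v) // [X in _ <= X](bigD1 v) //= (negbTE nuv) add0n addnC.
  apply: leq_add; first by rewrite lt0b; apply/same_linkP.
  apply: leq_sum => y yv; apply: leq_bool.
  move=> /same_linkP H; apply/same_linkP => a b.
  by rewrite /h' /(clone u v y) /(clone u v v) (negbTE yv) eqxx.
have := linkpairs_split h v; have := linkpairs_split h' v; lia.
Qed.

(* Zykov symmetrization: cloning raises the number of edges, or keeps it and
   raises the number of pairs of vertices with equal links. *)
Lemma symmetrization_ind (V : finType) (P : (V -> V -> V -> bool) -> Prop) :
  (forall h, good h -> symmetrized h -> P h) ->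
  (forall h u v, good h -> (forall w, ~~ h u v w) ->
    odeg h [set: V] v <= odeg h [set: V] u ->
    P (fun x y z => h (clone u v x) (clone u v y) (clone u v z)) -> P h) ->
  forall h, good h -> P h.
Proof.
move=> Psym Pclone.
(* A lexicographic order packed into one number: [linkpairs] never exceeds [n * n]. *)
pose n := #|V|; pose mu (h : V -> V -> V -> bool) := oedges h * (n * n).+1 + linkpairs h.
have mub h : mu h <= n * (n * n) * (n * n).+1 + n * n.
  apply: leq_add.
    rewrite leq_mul2r; apply/orP; right; apply: sum_const_le => x _; rewrite odegT.
    by apply: sum_const_le => y _; apply: sum_bool_le.
  by apply: sum_const_le => y _; apply: sum_bool_le.
have step h : good h -> ~ symmetrized h -> exists u v,
    [/\ forall w, ~~ h u v w, odeg h [set: V] v <= odeg h [set: V] u &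
    mu h < mu (fun x y z => h (clone u v x) (clone u v y) (clone u v z))].
  move=> gh /not_all_ex_not[u0] /not_all_ex_not[v0] N; have sh := good_sym gh.
  have [n0 /negP l0] := imply_to_and _ _ N.
  (* Lexicographic again: degree, then size of the twin class. The vertex that is larger in this
     order is the one copied. *)
  pose ms x := odeg h [set: V] x * n.+1 + \sum_y same_link h x y.
  have [u [v [nuv luv msuv]]] : exists u v,
      [/\ forall w, ~~ h u v w, ~~ same_link h u v & ms v <= ms u].
    case: (leqP (ms v0) (ms u0)) => [le|/ltnW le]; [by exists u0, v0 | exists v0, u0].
    split=> // [w|]; first by rewrite (sym3l sh).
    by apply: contraNN l0 => /same_linkP l; apply/same_linkP => a b; rewrite l.
  have Cb x : \sum_y (same_link h x y : nat) <= n by apply: sum_bool_le.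
  have duv : odeg h [set: V] v <= odeg h [set: V] u.
    by move: msuv (Cb u) (Cb v); rewrite /ms; nia.
  exists u, v; split=> //; set h' := fun x y z => _.
  have E := clone_oedges sh nuv; rewrite -/h' in E.
  case: (ltngtP (odeg h [set: V] v) (odeg h [set: V] u)) => [lt|gt|eq].
  - have : linkpairs h <= n * n by apply: sum_const_le => y _; apply: sum_bool_le.
    by rewrite /mu; nia.
  - by move: duv; rewrite leqNgt gt.
  - have Cuv : \sum_y (same_link h v y : nat) <= \sum_y same_link h u y.
      by move: msuv; rewrite /ms eq leq_add2l.
    have := clone_linkpairs luv Cuv; rewrite -/h' /mu eq in E *; move: E; nia.
suff main k h : good h -> n * (n * n) * (n * n).+1 + n * n <= k + mu h -> P h.
  by move=> h gh; apply: (main _ h gh (leq_addr _ _)).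
elim: k h => [|k IH] h gh hk.
all: case: (classic (symmetrized h)) => [/(Psym h gh)//|/(step h gh)[u [v [nuv duv lt]]]].
- by have := leq_ltn_trans hk lt; rewrite ltnNge mub.
- apply: (Pclone h u v gh nuv duv); apply: IH; first exact: good_pullback.
  by apply: leq_trans hk _; rewrite addSn -addnS leq_add2l.
Qed.

(** * Generic tuples *)

Lemma card_triples (V : finType) (R : V -> V -> V -> bool) :
  #|[set p : V * V * V | R p.1.1 p.1.2 p.2]| = \sum_x \sum_y \sum_z R x y z.
Proof.
rewrite pair_bigA pair_bigA /= -sum1_card big_mkcond /=.
by apply: eq_bigr => p _; rewrite inE; case: (R _ _ _).
Qed.

(** Exchanging three coordinates of a tuple with an arbitrary triple is injective; so [R] holds for
    no larger a proportion of tuples than of triples. *)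
Lemma card_tuple_fiber (V : finType) (i j k : 'I_6) (R : V -> V -> V -> bool) :
  i != j -> i != k -> j != k -> 0 < #|V| ->
  #|[set z : {ffun 'I_6 -> V} | R (z i) (z j) (z k)]| <=
  (\sum_x \sum_y \sum_z R x y z) * #|V| ^ 3.
Proof.
move=> ij ik jk V0; set A := [set z | _].
pose f (q : {ffun 'I_6 -> V} * (V * V * V)) : (V * V * V) * {ffun 'I_6 -> V} :=
  let: (z, (a, b, c)) := q in
  ((z i, z j, z k), [ffun l => if l == i then a else if l == j then b else
                               if l == k then c else z l]).
have fi : injective f.
  move=> [z [[a b] c]] [z' [[a' b'] c']] [Ei Ej Ek] /ffunP E.
  have := E i; have := E j; have := E k; rewrite !ffunE !eqxx.
  rewrite !(eq_sym k) (eq_sym j i) (negbTE ij) (negbTE ik) (negbTE jk) => -> -> ->.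
  congr (_, _).
  apply/ffunP => l; have := E l; rewrite !ffunE.
  by case: (eqVneq l i) => [->//|_]; case: (eqVneq l j) => [->//|_]; case: (eqVneq l k) => [->//|].
have sub : f @: setX A [set: V * V * V] \subset
    setX [set p : V * V * V | R p.1.1 p.1.2 p.2] [set: {ffun 'I_6 -> V}].
  by apply/subsetP => _ /imsetP[[z [[a b] c]] + ->]; rewrite !inE /= !andbT.
have := subset_leq_card sub.
rewrite (card_imset _ fi) !cardsX !cardsT card_ffun card_ord !card_prod card_triples.
have -> : (#|V| ^ 6 = #|V| ^ 3 * (#|V| * #|V| * #|V|))%N by rewrite !expnS expn0; lia.
by rewrite [X in _ <= X -> _]mulnA leq_pmul2r ?muln_gt0 ?V0.
Qed.

(** A union bound over 216 = 6^3 index triples: each spoils at most a fraction 1/m of all tuples,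
    while at least a fraction 7^-6 of them has its entries in the sets [D i]. *)
Lemma generic_tuple (V : finType) (D : 'I_6 -> {set V})
    (R : 'I_6 -> 'I_6 -> 'I_6 -> V -> V -> V -> bool) (m : nat) :
  0 < #|V| -> (forall i, #|V| <= 7 * #|D i|) -> 216 * 7 ^ 6 < m ->
  (forall i j k, i != j -> i != k -> j != k ->
     m * (\sum_x \sum_y \sum_z R i j k x y z) <= #|V| ^ 3) ->
  exists2 z : {ffun 'I_6 -> V}, forall i, z i \in D i &
    forall i j k, i != j -> i != k -> j != k -> ~~ R i j k (z i) (z j) (z k).
Proof.
move=> V0 D7 m_big HR; apply: NNPP => N.
pose dist (t : 'I_6 * 'I_6 * 'I_6) := [&& t.1.1 != t.1.2, t.1.1 != t.2 & t.1.2 != t.2].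
pose bad (t : 'I_6 * 'I_6 * 'I_6) := [set z : {ffun 'I_6 -> V} |
  dist t && R t.1.1 t.1.2 t.2 (z t.1.1) (z t.1.2) (z t.2)].
pose Dom := [set z : {ffun 'I_6 -> V} | [forall i, z i \in D i]].
have sub : Dom \subset \bigcup_t bad t.
  apply/subsetP => z; rewrite inE => /forallP zD; apply/negPn/negP => zN; apply: N.
  exists z => // i j k ij ik jk; apply: contraNN zN => Rz.
  by apply/bigcupP; exists (i, j, k) => //; rewrite inE /dist /= ij ik jk.
have cDom : #|V| ^ 6 <= 7 ^ 6 * #|Dom|.
  have -> : #|Dom| = #|(finfun.family (fun i => mem (D i)) : simpl_pred {ffun 'I_6 -> V})|.
    by apply: eq_card => z; rewrite inE; apply/forallP/familyP.
  rewrite card_family foldrE big_map.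
  have -> : 7 ^ 6 = \prod_(i <- enum 'I_6) 7 by rewrite big_enum prod_nat_const card_ord.
  have -> : #|V| ^ 6 = \prod_(i <- enum 'I_6) #|V| by rewrite big_enum prod_nat_const card_ord.
  by rewrite -big_split; apply: leq_prod => i _; apply: D7.
have cbad t : m * #|bad t| <= #|V| ^ 6.
  case: (boolP (dist t)) => dt; last first.
    by rewrite (eq_card0 (A := bad t)) ?muln0 // => z; rewrite inE (negbTE dt).
  have/and3P[ij ik jk] := dt.
  have := card_tuple_fiber (R t.1.1 t.1.2 t.2) ij ik jk V0; have := HR _ _ _ ij ik jk.
  have -> : bad t = [set z : {ffun 'I_6 -> V} |
      R t.1.1 t.1.2 t.2 (z t.1.1) (z t.1.2) (z t.2)] by apply/setP => z; rewrite !inE dt.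
  have -> : #|V| ^ 6 = #|V| ^ 3 * #|V| ^ 3 by rewrite -expnD.
  by move: (\sum_x _) #|_| (#|V| ^ 3) => a b c; nia.
have cU : m * #|\bigcup_t bad t| <= 216 * #|V| ^ 6.
  apply: (@leq_trans (\sum_t m * #|bad t|)).
    rewrite -big_distrr leq_mul2l; apply/orP; right.
    apply: (big_ind2 (fun (A : {set {ffun 'I_6 -> V}}) k => #|A| <= k)) => //.
      by rewrite cards0.
    by move=> A a B b Aa Bb; apply: leq_trans (leq_card_setU _ _) (leq_add Aa Bb).
  apply: leq_trans (sum_const_le (m := #|V| ^ 6) _) _ => //.
  by rewrite !card_prod !card_ord.
have := subset_leq_card sub; have : 0 < #|V| ^ 6 by rewrite expn_gt0 V0.
move: cDom cU m_big; move: (7 ^ 6) (#|V| ^ 6) #|Dom| #|\bigcup_t bad t| => a b c d ba db am b0 cd.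
have l1 : m * b <= m * (a * c) by rewrite leq_mul2l ba orbT.
have l2 : (m * a) * c <= (m * a) * d by rewrite leq_mul2l cd orbT.
have l3 : a * (m * d) <= a * (216 * b) by rewrite leq_mul2l db orbT.
have l4 : (216 * a) * b < m * b by rewrite ltn_pmul2r.
lia.
Qed.

Definition missing (C V : finType) (al : C -> C -> C -> bool)
    (h : V -> V -> V -> bool) (W : {set V}) (c : V -> C) (x : V) : nat :=
  \sum_(y in W) \sum_(z in W) (al (c x) (c y) (c z) && ~~ h x y z).

Lemma has_le_sum (T : Type) (a : pred T) (s : seq T) : has a s <= \sum_(u <- s) a u.
Proof.
elim: s => [|u s IH]; first by rewrite big_nil.
by rewrite big_cons /=; case: (a u); case: (has a s) IH.
Qed.

(** The factor 13 is 1 + 12: one share for triples inside the tuple and one for each prescribed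
    vertex of [U]. The factor 7 leaves slack below the ideal class sizes 1/3, 2/3 and 1/6. *)
Lemma generic_core (C V : finType) (al : C -> C -> C -> bool)
    (h : V -> V -> V -> bool) (W : {set V}) (c : V -> C) (ty : 'I_6 -> C)
    (m : nat) (U : seq V) :
  0 < #|V| -> (forall i, #|V| <= 7 * #|[set x in W | c x == ty i]|) ->
  216 * 7 ^ 6 < m -> size U <= 12 -> {subset U <= W} ->
  (forall x, x \in W -> 13 * m * missing al h W c x <= #|V| ^ 2) ->
  exists z : 'I_6 -> V, [/\ forall i, z i \in W /\ c (z i) = ty i,
    forall i j k, i != j -> i != k -> j != k ->
      al (ty i) (ty j) (ty k) -> h (z i) (z j) (z k) &
    forall u j k, u \in U -> j != k -> al (c u) (ty j) (ty k) ->
      h u (z j) (z k)].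
Proof.
move=> V0 big m_big U12 UW few.
pose cls (i : 'I_6) := [set x in W | c x == ty i].
pose R i j k x y w := [&& x \in cls i, y \in cls j, w \in cls k &
  (al (ty i) (ty j) (ty k) && ~~ h x y w) ||
  has (fun u => al (c u) (ty j) (ty k) && ~~ h u y w) U].
have RP i j k x y w : R i j k x y w <=
    [&& x \in W, y \in W, w \in W, al (c x) (c y) (c w) & ~~ h x y w] +
    \sum_(u <- U) [&& y \in W, w \in W, al (c u) (c y) (c w) & ~~ h u y w].
  rewrite /R !inE.
  case: (boolP (x \in W)) => //= xW; case: (boolP (y \in W)) => yW; rewrite ?andbF //=.
  case: (boolP (w \in W)) => wW; rewrite ?andbF //=.
  case: eqP => //= <-; case: eqP => //= <-; case: eqP => //= <-.
  case: (boolP (_ && _)) => //= _; exact: has_le_sum.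
have [|z zD zR] := @generic_tuple V cls R m V0 big m_big.
  move=> i j k ij ik jk.
  have sumR : \sum_x \sum_y \sum_w R i j k x y w <=
      \sum_(x in W) missing al h W c x + \sum_(u <- U) #|V| * missing al h W c u.
    apply: (@leq_trans (\sum_x \sum_y \sum_w
      ([&& x \in W, y \in W, w \in W, al (c x) (c y) (c w) & ~~ h x y w] +
       \sum_(u <- U) [&& y \in W, w \in W, al (c u) (c y) (c w) & ~~ h u y w]))).
      by apply: leq_sum => x _; apply: leq_sum => y _; apply: leq_sum => w _.
    have mE (b : bool) u : (if b then missing al h W c u else 0) =
       \sum_y \sum_w [&& b, y \in W, w \in W, al (c u) (c y) (c w) & ~~ h u y w].
      case: b; last by rewrite big1 // => y _; rewrite big1.
      rewrite /missing big_mkcond; apply: eq_bigr => y _.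
      case: ifP => yW /=; last by rewrite big1.
      by rewrite big_mkcond; apply: eq_bigr => w _; case: ifP.
    rewrite (eq_bigr (fun x => (if x \in W then missing al h W c x else 0) +
        \sum_(u <- U) missing al h W c u)); last first.
      move=> x _; rewrite mE.
      rewrite [X in _ = _ + X](eq_bigr (fun u => \sum_y \sum_w
        ([&& y \in W, w \in W, al (c u) (c y) (c w) & ~~ h u y w] : nat))); last first.
        by move=> u _; exact: (mE true u).
      rewrite [X in _ = _ + X]exchange_big -big_split; apply: eq_bigr => y _.
      by rewrite [X in _ = _ + X]exchange_big -big_split.
    rewrite big_split -big_mkcond /= leq_add2l sum_nat_const -big_distrr /=.
    by rewrite leqnn.
  have s1 : 13 * m * \sum_(x in W) missing al h W c x <= #|V| * #|V| ^ 2.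
    by rewrite big_distrr; apply: sum_const_le => x; apply: few.
  have s2 : 13 * m * \sum_(u <- U) #|V| * missing al h W c u <= 12 * (#|V| * #|V| ^ 2).
    apply: (@leq_trans (\sum_(u <- U) #|V| * #|V| ^ 2)).
      rewrite big_distrr big_seq [X in _ <= X]big_seq; apply: leq_sum => u uU /=.
      by rewrite mulnCA leq_mul2l few ?orbT //; apply: UW.
    by rewrite big_const_seq count_predT iter_addn_0 mulnC leq_mul2r U12 orbT.
  rewrite (expnS _ 2) -(leq_pmul2l (isT : 0 < 13)) mulnA.
  apply: leq_trans (_ : 13 * m * (\sum_(x in W) missing al h W c x +
    \sum_(u <- U) #|V| * missing al h W c u) <= _); first by rewrite leq_mul2l sumR orbT.
  by rewrite mulnDr; lia.
have zP i : z i \in W /\ c (z i) = ty i.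
  by have := zD i; rewrite inE => /andP[? /eqP].
exists z; split=> // [i j k ij ik jk al_ijk|u j k uU jk al_ujk].
  have := zR i j k ij ik jk; rewrite /R !zD al_ijk /= negb_or negbK.
  by case/andP.
(* A failure at [u] involves only two entries of [z]; a third index is added to match the ternary
   form of [R]. *)
have [i ij ik] : exists2 i : 'I_6, i != j & i != k.
  have : 0 < #|~: [set j; k]| by rewrite cardsCs setCK cards2 card_ord jk.
  by rewrite card_gt0 => /set0Pn[i]; rewrite !inE negb_or => /andP[]; exists i.
have := zR i j k ij ik jk; rewrite /R !zD /= negb_or => /andP[_ /hasPn/(_ u uU)].
by rewrite al_ujk negbK.
Qed.

(** * Extending a colouring by one vertex *)

Lemma extension_obstruction (C V : finType) (al : C -> C -> C -> bool)
    (h : V -> V -> V -> bool) (W : {set V}) (c : V -> C) (v : V) (t : C) :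
  (forall x y z, al x y z = al y x z) -> (forall x y z, al x y z = al x z y) ->
  sym3 h -> v \notin W -> coloring al h W c ->
  ~ (exists c', coloring al h (v |: W) c') ->
  exists p : V * V, [/\ p.1 \in W, p.2 \in W, h v p.1 p.2 & ~~ al t (c p.1) (c p.2)].
Proof.
move=> all alr sh vW cW N; apply: NNPP => N2; apply: N.
have vP x y : x \in W -> y \in W -> h v x y -> al t (c x) (c y).
  by move=> xW yW hv; apply/negPn/negP => nal; apply: N2; exists (x, y).
exists (fun x => if x == v then t else c x) => x y z; rewrite !inE => xX yX zX hxyz.
have [xy xz yz] := sym3_neq sh hxyz.
have inW u : (u == v) || (u \in W) -> u != v -> u \in W by case/orP=> // ->.
case: (eqVneq x v) => [E|nx].
  rewrite E in xy xz hxyz; rewrite eq_sym in xy; rewrite eq_sym in xz.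
  by rewrite (negbTE xy) (negbTE xz); apply: vP => //; exact: inW.
case: (eqVneq y v) => [E|ny].
  rewrite E in xy yz hxyz; rewrite eq_sym in yz.
  by rewrite (negbTE yz) all; apply: vP; [exact: inW | exact: inW | rewrite (sym3l sh)].
case: (eqVneq z v) => [E|nz]; last by apply: cW => //; exact: inW.
by rewrite alr all; apply: vP; [exact: inW | exact: inW | rewrite (sym3l sh) (sym3r sh) -E].
Qed.

(** * Finite checks on [G26]: links and automorphisms *)

Lemma all_iotaP (n : nat) (P : pred nat) :
  all P (iota 0 n) -> forall i : 'I_n, P i.
Proof. by move=> /allP H i; apply: H; rewrite mem_iota ltn_ord. Qed.

Lemma has_iotaP (n : nat) (P : pred nat) :
  has P (iota 0 n) -> exists i : 'I_n, P i.
Proof.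
by case/hasP=> i; rewrite mem_iota add0n => /andP[_ i_n] Pi; exists (Ordinal i_n).
Qed.

(** Links in [G26] form an antichain; thus the triples of a vertex with a coloured core determine
    its colour. *)
Lemma g26_link_inj (i s : 'I_6) :
  (forall j k, j != k -> g26 i j k -> g26 s j k) -> s = i.
Proof.
move=> H; apply/eqP; apply/negPn/negP => si.
have /all_iotaP/(_ i)/all_iotaP/(_ s) : all (fun i => all (fun s => (s == i) ||
    has (fun j => has (fun k => g26_nat i j k && ~~ g26_nat s j k) (iota 0 6)) (iota 0 6))
    (iota 0 6)) (iota 0 6) by [].
rewrite (inj_eq val_inj) (negbTE si) orFb => /has_iotaP[j /has_iotaP[k]].
rewrite -!g26E => /andP[ijk /negP]; apply; apply: H => //.
by have [] := sym3_neq g26_sym ijk.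
Qed.

(** Rules out a [g26] colouring of the semibipartite core, where one vertex forms a triple with any
    two of the other five. *)
Lemma g26_link_incomplete (i : 'I_6) :
  exists j k, [/\ i != j, i != k, j != k & ~~ g26 i j k].
Proof.
have /all_iotaP/(_ i)/has_iotaP[j /has_iotaP[k]] : all (fun i => has (fun j => has (fun k =>
    [&& i != j, i != k, j != k & ~~ g26_nat i j k]) (iota 0 6)) (iota 0 6)) (iota 0 6) by [].
by rewrite -g26E => /and4P[? ? ? ?]; exists j, k.
Qed.

Lemma g26_covered (i j : 'I_6) : i != j -> exists k, g26 i j k.
Proof.
have /all_iotaP/(_ i)/all_iotaP/(_ j) : all (fun i => all (fun j => (i != j) ==>
  has (fun k => g26_nat i j k) (iota 0 6)) (iota 0 6)) (iota 0 6) by [].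
rewrite (inj_eq val_inj) => /implyP H /H/has_iotaP[k]; rewrite -g26E; by exists k.
Qed.

(* An injective self-map of the finite set of edges is onto. *)
Lemma g26_endo_auto (s : 'I_6 -> 'I_6) : injective s ->
  (forall i j k, g26 i j k -> g26 (s i) (s j) (s k)) ->
  forall i j k, g26 (s i) (s j) (s k) -> g26 i j k.
Proof.
move=> si H; pose sG := [set s @: e | e : {set 'I_6} in G26].
have sub : sG \subset G26.
  apply/subsetP => _ /imsetP[e eG ->].
  have /cards3P[i [j [k [_ _ _ E]]]] : #|e| = 3 by move: eG; rewrite inE => /andP[/eqP].
  by rewrite E imset_set3; apply: H; rewrite /g26 -E.
have sG_eq : sG = G26 by apply/eqP; rewrite eqEcard sub card_imset ?leqnn //; exact: imset_inj si.
move=> i j k; rewrite /g26 -sG_eq => /imsetP[e eG].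
by rewrite -imset_set3 sG_eq => /(imset_inj si) ->.
Qed.

Lemma core_image (V : finType) (h : V -> V -> V -> bool) (z : 'I_6 -> V) :
  sym3 h -> (forall i j, i != j -> exists k, h (z i) (z j) (z k)) ->
  injective z /\ forall x y, x \in z @: setT -> y \in z @: setT -> x != y ->
    exists2 w, w \in z @: setT & h x y w.
Proof.
move=> sh cz; split=> [i j zij|_ _ /imsetP[i _ ->] /imsetP[j _ ->] zij].
  by apply/eqP/negPn/negP => /cz[k]; rewrite zij (sym3i sh).
have [|k hk] := cz i j; first by apply: contraNneq zij => ->.
by exists (z k) => //; apply: imset_f.
Qed.

(** The set has at most 6 + 1 + 12 = 19 vertices, within the 21 allowed by [good_core6]. *)
Lemma core_colorable (V : finType) (h : V -> V -> V -> bool) (z : 'I_6 -> V)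
    (v : V) (U : seq V) : good h -> size U <= 12 ->
  (forall i j, i != j -> exists k, h (z i) (z j) (z k)) ->
  colorable h (z @: setT :|: [set x in v :: U]).
Proof.
move=> gh U12 cz; have [zi cS] := core_image (good_sym gh) cz.
have zc : #|z @: [set: 'I_6]| = 6 by rewrite card_imset // cardsT card_ord.
apply: (good_core6 gh (S := z @: setT)) => //; first exact: subsetUl.
  apply: leq_trans (leq_card_setU _ _) _; rewrite zc.
  apply: (@leq_trans (6 + 13)) => //; rewrite leq_add2l cardsE.
  exact: leq_trans (card_size _) _.
by move=> x y xS yS xy; have [w wS hw] := cS x y xS yS xy; exists w => //; rewrite inE wS.
Qed.

(** The core has one vertex [z ord0] of colour [true] and five of colour [false]. Its [exactly_one]
    colouring is forced, hence also the colours of the four obstructing vertices, and either colour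
    of [v] violates one of the two obstructions. *)
Lemma extend_semibipartite (V : finType) (h : V -> V -> V -> bool) (W : {set V})
    (c : V -> bool) (v : V) (m : nat) :
  good h -> coloring exactly_one h W c -> v \notin W ->
  (forall t, #|V| <= 7 * #|[set x in W | c x == t]|) -> 216 * 7 ^ 6 < m ->
  (forall x, x \in W -> 13 * m * missing exactly_one h W c x <= #|V| ^ 2) ->
  colorable h (v |: W).
Proof.
move=> gh cW vW big m_big few; have sh := good_sym gh; apply: NNPP => N.
have obs t : exists p : V * V, [/\ p.1 \in W, p.2 \in W, h v p.1 p.2 & ~~ exactly_one t (c p.1) (c p.2)].
  apply: (extension_obstruction t _ _ sh vW cW); [by case; case; case | by case; case; case |].
  by move=> E; apply: N; left.
have [p1 [x1W y1W h1 n1]] := obs true; have [p2 [x2W y2W h2 n2]] := obs false.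
pose U := [:: p1.1; p1.2; p2.1; p2.2]; pose ty (i : 'I_6) := i == ord0.
have [|||z [zW zc zU]] := @generic_core _ _ exactly_one h W c ty m U _ (fun i => big (ty i)) m_big _ _ few => //.
- by apply/card_gt0P; exists v.
- by move=> u; rewrite !inE => /or4P[]/eqP->.
pose o1 : 'I_6 := inord 1; pose o2 : 'I_6 := inord 2; pose o3 : 'I_6 := inord 3.
have od (i j : nat) : i < 6 -> j < 6 -> i != j -> (inord i : 'I_6) != inord j.
  by move=> i6 j6; rewrite -(inj_eq val_inj) /= !inordK.
have o0 : ord0 = inord 0 :> 'I_6 by apply: val_inj; rewrite /= inordK.
have z0 j k : j != ord0 -> k != ord0 -> j != k -> h (z ord0) (z j) (z k).
  move=> j0 k0 jk; apply: zc; rewrite // 1?eq_sym //.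
  by rewrite /ty eqxx (negbTE j0) (negbTE k0).
have other (j : 'I_6) : exists2 k : 'I_6, k != ord0 & j != k.
  case: (eqVneq j o1) => [->|j1]; [exists o2 | exists o1]; rewrite ?o0 ?od //.
have cz i j : i != j -> exists k, h (z i) (z j) (z k).
  case: (eqVneq i ord0) => [->|i0].
    rewrite eq_sym => j0; have [k k0 jk] := other j; by exists k; apply: z0.
  case: (eqVneq j ord0) => [->|j0] ij.
    by have [k k0 ik] := other i; exists k; rewrite (sym3l sh); apply: z0.
  by exists ord0; rewrite (sym3r sh) (sym3l sh); apply: z0.
have zX i : z i \in z @: setT :|: [set x in v :: U] by rewrite inE imset_f.
have uX u : u \in v :: U -> u \in z @: setT :|: [set x in v :: U].
  by move=> uU; rewrite !in_setU in_set uU orbT.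
have [//|[chi Hc]|[chi Hc]] := @core_colorable _ h z v U gh _ cz.
- have e0 j k : j != ord0 -> k != ord0 -> j != k ->
      exactly_one (chi (z ord0)) (chi (z j)) (chi (z k)).
    by move=> *; apply: Hc => //; apply: z0.
  (* Otherwise any two of three further core vertices would have different boolean colours. *)
  have c0 : chi (z ord0).
    have := e0 o1 o2; have := e0 o1 o3; have := e0 o2 o3.
    rewrite o0 !od // => /(_ isT isT isT) + /(_ isT isT isT) + /(_ isT isT isT).
    by case: (chi _); case: (chi _); case: (chi _); case: (chi _).
  have cj j : j != ord0 -> chi (z j) = false.
    move=> j0; have [k k0 jk] := other j; have := e0 j k j0 k0 jk; rewrite c0.
    by case: (chi (z j)).
  have o10 : o1 != ord0 by rewrite o0 od.
  have o20 : o2 != ord0 by rewrite o0 od.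
  have o12 : o1 != o2 by rewrite od.
  have cU u : u \in U -> chi u = c u.
    move=> uU; have uXu : u \in v :: U by rewrite inE uU orbT.
    case cu: (c u).
      have : h u (z o1) (z o2).
        by apply: zU => //; rewrite cu /ty (negbTE o10) (negbTE o20).
      move/Hc => /(_ (uX u uXu) (zX _) (zX _)); rewrite !cj //.
      by case: (chi u).
    have : h u (z ord0) (z o1).
      by apply: zU => //; rewrite 1?eq_sym // cu /ty eqxx (negbTE o10).
    move/Hc => /(_ (uX u uXu) (zX _) (zX _)); rewrite c0 cj //.
    by case: (chi u).
  have vX : v \in v :: U by rewrite inE eqxx.
  have {}cU u : u \in U -> chi u = c u /\ u \in z @: setT :|: [set x in v :: U].
    by move=> uU; rewrite cU // uX // inE uU orbT.
  have [E1 X1] : chi p1.1 = c p1.1 /\ p1.1 \in z @: setT :|: [set x in v :: U]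
    by apply: cU; rewrite !inE eqxx.
  have [E2 X2] : chi p1.2 = c p1.2 /\ p1.2 \in z @: setT :|: [set x in v :: U]
    by apply: cU; rewrite !inE eqxx ?orbT.
  have [E3 X3] : chi p2.1 = c p2.1 /\ p2.1 \in z @: setT :|: [set x in v :: U]
    by apply: cU; rewrite !inE eqxx ?orbT.
  have [E4 X4] : chi p2.2 = c p2.2 /\ p2.2 \in z @: setT :|: [set x in v :: U]
    by apply: cU; rewrite !inE eqxx ?orbT.
  have := Hc _ _ _ (uX _ vX) X1 X2 h1; have := Hc _ _ _ (uX _ vX) X3 X4 h2.
  by rewrite E1 E2 E3 E4; case: (chi v) => ? ?; [move/negP: n1 | move/negP: n2].
(* A [g26] colouring would be a bijection on the core and make the link of the colour of [z ord0]
   complete. *)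
- have si : injective (chi \o z).
    move=> i j /= E; apply/eqP/negPn/negP => /cz[k /Hc] /(_ (zX _) (zX _) (zX _)).
    by rewrite E (sym3i g26_sym).
  have [j [k [ij ik jk /negP]]] := g26_link_incomplete (chi (z ord0)); apply.
  have onto x : exists y, chi (z y) = x by exists (invF si x); apply: (f_invF si).
  have [j' Ej] := onto j; have [k' Ek] := onto k; rewrite -Ej -Ek in ij ik jk *.
  have neq a b : chi (z a) != chi (z b) -> a != b by apply: contraNneq => ->.
  by apply: Hc => //; apply: z0; rewrite 1?eq_sym // neq // eq_sym.
Qed.

(** A [g26] colouring of the core is an automorphism of [G26]. By the antichain property it carries
    the old colour of each vertex of [U] to its new one. Read back through it, the colour of [v] is
    some [t], which [p t] forbids. *)
Lemma extend_G26 (V : finType) (h : V -> V -> V -> bool) (W : {set V})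
    (c : V -> 'I_6) (v : V) (m : nat) :
  good h -> coloring g26 h W c -> v \notin W ->
  (forall t, #|V| <= 7 * #|[set x in W | c x == t]|) -> 216 * 7 ^ 6 < m ->
  (forall x, x \in W -> 13 * m * missing g26 h W c x <= #|V| ^ 2) ->
  colorable h (v |: W).
Proof.
move=> gh cW vW big m_big few; have sh := good_sym gh; apply: NNPP => N.
have obs t : exists p : V * V, [/\ p.1 \in W, p.2 \in W, h v p.1 p.2 & ~~ g26 t (c p.1) (c p.2)].
  apply: (extension_obstruction t (sym3l g26_sym) (sym3r g26_sym) sh vW cW).
  by move=> E; apply: N; right.
have [p Hp] := fin_all_exists obs.
pose U := [seq (p t).1 | t <- enum 'I_6] ++ [seq (p t).2 | t <- enum 'I_6].
have U12 : size U <= 12 by rewrite size_cat 2!size_map size_enum_ord.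
have [||z [zW zc zU]] := @generic_core _ _ g26 h W c (fun i => i) m U _ big m_big U12 _ few.
- by apply/card_gt0P; exists v.
- by move=> u; rewrite mem_cat => /orP[]/mapP[t _ ->]; have [] := Hp t.
have {}zc i j k : g26 i j k -> h (z i) (z j) (z k).
  by move=> g; have [] := sym3_neq g26_sym g => *; apply: zc.
have cz i j : i != j -> exists k, h (z i) (z j) (z k).
  by move=> /g26_covered[k /zc]; exists k.
have zX i : z i \in z @: setT :|: [set x in v :: U] by rewrite inE imset_f.
have uX u : u \in v :: U -> u \in z @: setT :|: [set x in v :: U].
  by move=> uU; rewrite !in_setU in_set uU orbT.
have [[chi Hc]|[chi Hc]] := @core_colorable _ h z v U gh U12 cz.
- have e i j k : g26 i j k -> exactly_one (chi (z i)) (chi (z j)) (chi (z k)).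
    by move=> /zc; apply: Hc.
  (* The colours 0, 2, 3, 5 span all four triples. Each vertex lies in three of them, so exactly one
     [true] in each would give 3 times the number of [true] vertices equal to 4. *)
  have := e (inord 0) (inord 2) (inord 3); have := e (inord 0) (inord 2) (inord 5).
  have := e (inord 0) (inord 3) (inord 5); have := e (inord 2) (inord 3) (inord 5).
  rewrite !g26E !inordK // => /(_ isT) + /(_ isT) + /(_ isT) + /(_ isT).
  by case: (chi _); case: (chi _); case: (chi _); case: (chi _).
- have si : injective (chi \o z).
    move=> i j /= E; apply/eqP/negPn/negP => /cz[k /Hc] /(_ (zX _) (zX _) (zX _)).
    by rewrite E (sym3i g26_sym).
  have onto x : exists y, chi (z y) = x by exists (invF si x); apply: (f_invF si).
  have auto i j k : g26 (chi (z i)) (chi (z j)) (chi (z k)) -> g26 i j k.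
    by apply: (g26_endo_auto si) => a b d /zc /Hc; apply.
  have cU u : u \in U -> chi u = chi (z (c u)).
    move=> uU; have [s Es] := onto (chi u); rewrite -Es; congr (chi (z _)).
    apply: g26_link_inj => j k jk g; apply: auto; rewrite Es; apply: Hc => //.
      by apply: uX; rewrite inE uU orbT.
    exact: zU.
  have [t Et] := onto (chi v); have [xW yW hv /negP] := Hp t; apply.
  have U1 : (p t).1 \in U by rewrite mem_cat; apply/orP; left; apply/mapP; exists t; rewrite ?mem_enum.
  have U2 : (p t).2 \in U by rewrite mem_cat; apply/orP; right; apply/mapP; exists t; rewrite ?mem_enum.
  apply: auto; rewrite Et -!cU //; apply: Hc => //; apply: uX; rewrite inE ?eqxx //.
    by rewrite U1 orbT.
  by rewrite U2 orbT.
Qed.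

(** * Colour class sizes *)

Lemma INRD m n : INR (m + n) = (INR m + INR n)%R.
Proof. exact: plus_INR. Qed.

Lemma INRM m n : INR (m * n) = (INR m * INR n)%R.
Proof. exact: mult_INR. Qed.

Lemma INRX m n : INR (m ^ n) = (INR m ^ n)%R.
Proof. by elim: n => [|n IH]; rewrite ?expn0 // expnS INRM IH. Qed.

Lemma INR_leq m n : (m <= n) <-> (INR m <= INR n)%R.
Proof. by split=> [/leP/le_INR//|/INR_le/leP]. Qed.

Lemma INR_sum_ge (I : finType) (P : pred I) (F : I -> nat) (a : R) :
  (forall i, P i -> (a <= INR (F i))%R) ->
  (INR #|P| * a <= INR (\sum_(i | P i) F i))%R.
Proof.
move=> Fa; rewrite -sum1_card (eq_bigl P) //.
apply: (big_ind2 (fun m k => (INR m * a <= INR k)%R)); rewrite /= ?INRD.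
- lra.
- move=> a1 b1 a2 b2; rewrite !INRD; lra.
- by move=> i Pi; have := Fa i Pi; lra.
Qed.

Definition nclass (C V : finType) (W : {set V}) (c : V -> C) (t : C) : nat :=
  #|[set x in W | c x == t]|.

(* Number of ordered pairs completing a vertex of colour i to an admissible triple. *)
Definition full_odeg (C V : finType) (al : C -> C -> C -> bool) (W : {set V})
    (c : V -> C) (i : C) : nat :=
  \sum_j nclass W c j * \sum_k nclass W c k * al i j k.

Lemma sum_classes (C V : finType) (W : {set V}) (c : V -> C) (F : C -> nat) :
  \sum_(y in W) F (c y) = \sum_j nclass W c j * F j.
Proof.
rewrite (partition_big c predT) //=; apply: eq_bigr => j _.
rewrite (eq_bigr (fun=> F j)) => [|y /andP[_ /eqP->]//].
by rewrite sum_nat_cond_const; congr (_ * _); apply: eq_card => x; rewrite !inE.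
Qed.

Lemma missing_odeg (C V : finType) (al : C -> C -> C -> bool)
    (h : V -> V -> V -> bool) (W : {set V}) (c : V -> C) (x : V) :
  coloring al h W c -> x \in W ->
  missing al h W c x + odeg h W x = full_odeg al W c (c x).
Proof.
move=> cW xW; rewrite /full_odeg -(sum_classes W c (fun j => \sum_k nclass W c k * al (c x) j k)).
rewrite -big_split; apply: eq_bigr => y yW.
rewrite -(sum_classes W c (al (c x) (c y))) -big_split; apply: eq_bigr => z zW /=.
have := cW x y z xW yW zW; case: (h x y z) => [->//|_] /=.
by rewrite andbT addn0.
Qed.

Lemma sum_ord6 (f : 'I_6 -> nat) :
  \sum_i f i = f (inord 0) + f (inord 1) + f (inord 2) + f (inord 3) + f (inord 4) + f (inord 5).
Proof.
rewrite !big_ord_recl big_ord0 addn0 !addnA.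
by do 5?[congr (_ + _)]; congr (f _); apply: val_inj; rewrite /= inordK.
Qed.

Lemma ord6_ind (P : 'I_6 -> Prop) :
  P (inord 0) -> P (inord 1) -> P (inord 2) -> P (inord 3) -> P (inord 4) ->
  P (inord 5) -> forall i, P i.
Proof.
move=> P0 P1 P2 P3 P4 P5 i; rewrite -(inord_val i).
by case: i => [[|[|[|[|[|[|?]]]]]] ?].
Qed.

Lemma full_odeg_semibipartite (V : finType) (W : {set V}) (c : V -> bool) t :
  full_odeg exactly_one W c t =
  if t then nclass W c false * nclass W c false
  else 2 * (nclass W c true * nclass W c false).
Proof. by rewrite /full_odeg !big_bool /=; case: t; rewrite /exactly_one /=; lia. Qed.

(** The letters name the pairs {0,1}, {2,5}, {3,4}. The listed polynomials are the partial
    derivatives of the edge polynomial of [G26], doubled for ordered pairs. *)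
Lemma full_odeg_G26 (V : finType) (W : {set V}) (c : V -> 'I_6) i :
  let n k := nclass W c (inord k) in
  let p1 := n 0 in let p2 := n 1 in let q1 := n 2 in
  let r1 := n 3 in let r2 := n 4 in let q2 := n 5 in
  full_odeg g26 W c i = 2 * nth 0
    [:: p2 * (r1 + r2) + q1 * q2 + (q1 + q2) * (r1 + r2) + r1 * r2;
        p1 * (r1 + r2) + q1 * q2 + (q1 + q2) * (r1 + r2) + r1 * r2;
        (p1 + p2) * (r1 + r2) + q2 * (p1 + p2 + r1 + r2);
        r2 * (p1 + p2) + q1 * q2 + (q1 + q2) * (p1 + p2) + p1 * p2;
        r1 * (p1 + p2) + q1 * q2 + (q1 + q2) * (p1 + p2) + p1 * p2;
        (p1 + p2) * (r1 + r2) + q1 * (p1 + p2 + r1 + r2)] i.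
Proof.
move: i; apply: ord6_ind; rewrite /full_odeg !sum_ord6 !g26E !inordK //=; lia.
Qed.

(** Averaging inside each pair, then between [p] and [r], costs the listed squares. What remains is
    a cubic in [w] with a double zero at [s / 3]. Since [w <= s / 2] for nonnegative weights, all
    squares have nonnegative coefficients. *)
Lemma G26_lagrangian_gap (p1 p2 q1 q2 r1 r2 : R) :
  let p := (p1 + p2)%R in let q := (q1 + q2)%R in let r := (r1 + r2)%R in
  let s := (p + q + r)%R in let w := ((p + r) / 2)%R in
  (2 / 27 * s ^ 3 - (p * q * r + q1 * q2 * (p + r) + p1 * p2 * r + r1 * r2 * p) =
   / 2 * (w - s / 3) ^ 2 * (4 / 3 * s - w) + (q1 - q2) ^ 2 * (p + r) / 4 +
   (p1 - p2) ^ 2 * r / 4 + (r1 - r2) ^ 2 * p / 4 +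
   (p - r) ^ 2 * (q + (p + r) / 4) / 4)%R.
Proof. by rewrite /=; field. Qed.

Lemma Rmul_sq_ge0 (a b : R) : (0 <= b)%R -> (0 <= a ^ 2 * b)%R.
Proof. by move=> b0; apply: Rmult_le_pos => //; apply: pow2_ge_0. Qed.

Lemma small_of_sq (x k gam eta : R) :
  (/ 32 <= k -> 0 < eta -> 32 * gam <= eta ^ 2 -> x ^ 2 * k <= gam ->
   - eta <= x <= eta)%R.
Proof.
move=> k0 e0 ge xk; have xe : (x ^ 2 <= eta ^ 2)%R by have := pow2_ge_0 x; nra.
by split; nra.
Qed.

(** Each term of the gap is at most [gam], and a coefficient of at least 1/32 turns this into a
    bound on the square. *)
Lemma G26_lagrangian_stable (p1 p2 q1 q2 r1 r2 eta gam : R) :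
  (0 <= p1 -> 0 <= p2 -> 0 <= q1 -> 0 <= q2 -> 0 <= r1 -> 0 <= r2 ->
   0 < eta -> eta <= / 100 -> 0 <= gam -> 32 * gam <= eta ^ 2 ->
   1 - gam <= p1 + p2 + q1 + q2 + r1 + r2 -> p1 + p2 + q1 + q2 + r1 + r2 <= 1 ->
   2 / 27 - gam <= (p1 + p2) * (q1 + q2) * (r1 + r2) + q1 * q2 * (p1 + p2 + (r1 + r2))
     + p1 * p2 * (r1 + r2) + r1 * r2 * (p1 + p2) ->
   [/\ Rabs (p1 - / 6) <= 3 * eta, Rabs (p2 - / 6) <= 3 * eta &
       Rabs (q1 - / 6) <= 3 * eta] /\
   [/\ Rabs (q2 - / 6) <= 3 * eta, Rabs (r1 - / 6) <= 3 * eta &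
       Rabs (r2 - / 6) <= 3 * eta])%R.
Proof.
move=> p10 p20 q10 q20 r10 r20 e0 e1 g0 ge s0 s1 L.
have := G26_lagrangian_gap p1 p2 q1 q2 r1 r2; rewrite /=.
set p := (p1 + p2)%R in L *; set q := (q1 + q2)%R in L *; set r := (r1 + r2)%R in L *.
set s := (p + q + r)%R; set w := ((p + r) / 2)%R => gap.
have [p0 q0 r0] : [/\ 0 <= p, 0 <= q & 0 <= r]%R by rewrite /p /q /r; split; lra.
have sE : (p1 + p2 + q1 + q2 + r1 + r2 = s)%R by rewrite /s /p /q /r; ring.
rewrite sE in s0 s1.
have ge' : (gam <= eta / 100)%R by nra.
have s3 : (s * (s * (s * 1)) <= 1)%R by have : (s * s <= 1)%R; nra.
have w0 : (w <= s / 2)%R by rewrite /w /s; lra.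
have k1 : (/ 32 <= / 2 * (4 / 3 * s - w))%R by lra.
have A0 := @Rmul_sq_ge0 (w - s / 3)%R (/ 2 * (4 / 3 * s - w))%R; rewrite /= in A0.
have B0 := @Rmul_sq_ge0 (q1 - q2)%R ((p + r) / 4)%R; rewrite /= in B0.
have C0 := @Rmul_sq_ge0 (p1 - p2)%R (r / 4)%R; rewrite /= in C0.
have D0 := @Rmul_sq_ge0 (r1 - r2)%R (p / 4)%R; rewrite /= in D0.
have E0 := @Rmul_sq_ge0 (p - r)%R ((q + (p + r) / 4) / 4)%R; rewrite /= in E0.
have {}A0 := A0 ltac:(lra); have {}B0 := B0 ltac:(lra); have {}C0 := C0 ltac:(lra).
have {}D0 := D0 ltac:(lra); have {}E0 := E0 ltac:(lra).
(* This term has to come first: it puts [p + r] near 2/3, from which the other coefficients get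
   their lower bounds. *)
have [wl wu] := @small_of_sq (w - s / 3)%R _ gam eta k1 e0 ge ltac:(rewrite /=; lra).
have k2 : (/ 32 <= (p + r) / 4)%R by rewrite /w in wl; lra.
have k3 : (/ 32 <= (q + (p + r) / 4) / 4)%R by rewrite /w in wl; lra.
have [ql qu] := @small_of_sq (q1 - q2)%R _ gam eta k2 e0 ge ltac:(rewrite /=; lra).
have [prl pru] := @small_of_sq (p - r)%R _ gam eta k3 e0 ge ltac:(rewrite /=; lra).
have k4 : (/ 32 <= r / 4)%R by rewrite /w in wl; lra.
have k5 : (/ 32 <= p / 4)%R by rewrite /w in wl; lra.
have [pl pu] := @small_of_sq (p1 - p2)%R _ gam eta k4 e0 ge ltac:(rewrite /=; lra).
have [rl ru] := @small_of_sq (r1 - r2)%R _ gam eta k5 e0 ge ltac:(rewrite /=; lra).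
by rewrite /w /s /p /q /r in wl wu prl pru s0 s1; split; split; apply: Rabs_le; lra.
Qed.

Lemma G26_lagrangian (p1 p2 q1 q2 r1 r2 : R) :
  (0 <= p1 -> 0 <= p2 -> 0 <= q1 -> 0 <= q2 -> 0 <= r1 -> 0 <= r2 ->
   (p1 + p2) * (q1 + q2) * (r1 + r2) + q1 * q2 * (p1 + p2 + (r1 + r2))
     + p1 * p2 * (r1 + r2) + r1 * r2 * (p1 + p2)
   <= 2 / 27 * (p1 + p2 + q1 + q2 + r1 + r2) ^ 3)%R.
Proof.
move=> p10 p20 q10 q20 r10 r20; have := G26_lagrangian_gap p1 p2 q1 q2 r1 r2; cbv zeta.
have -> : (p1 + p2 + (q1 + q2) + (r1 + r2) = p1 + p2 + q1 + q2 + r1 + r2)%R by ring.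
move=> gap.
have A0 := @Rmul_sq_ge0 ((p1 + p2 + (r1 + r2)) / 2 - (p1 + p2 + q1 + q2 + r1 + r2) / 3)%R
  (/ 2 * (4 / 3 * (p1 + p2 + q1 + q2 + r1 + r2) - (p1 + p2 + (r1 + r2)) / 2))%R ltac:(lra).
have B0 := @Rmul_sq_ge0 (q1 - q2)%R ((p1 + p2 + (r1 + r2)) / 4)%R ltac:(lra).
have C0 := @Rmul_sq_ge0 (p1 - p2)%R ((r1 + r2) / 4)%R ltac:(lra).
have D0 := @Rmul_sq_ge0 (r1 - r2)%R ((p1 + p2) / 4)%R ltac:(lra).
have E0 := @Rmul_sq_ge0 (p1 + p2 - (r1 + r2))%R ((q1 + q2 + (p1 + p2 + (r1 + r2)) / 4) / 4)%R ltac:(lra).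
lra.
Qed.

Lemma sum_full_odeg (C V : finType) (al : C -> C -> C -> bool)
    (h : V -> V -> V -> bool) (W : {set V}) (c : V -> C) :
  coloring al h W c ->
  \sum_(x in W) odeg h W x <= \sum_i nclass W c i * full_odeg al W c i.
Proof.
move=> cW; rewrite -(sum_classes W c (full_odeg al W c)); apply: leq_sum => x xW.
by rewrite -(missing_odeg cW xW) leq_addl.
Qed.

Lemma card_classes (C V : finType) (W : {set V}) (c : V -> C) :
  #|W| = \sum_i nclass W c i.
Proof.
rewrite -sum1_card (sum_classes W c (fun=> 1)); apply: eq_bigr => i _.
by rewrite muln1.
Qed.

Lemma sum_full_odeg_G26 (V : finType) (W : {set V}) (c : V -> 'I_6) :
  let n k := INR (nclass W c (inord k)) in
  INR (\sum_i nclass W c i * full_odeg g26 W c i) =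
  (6 * ((n 0%N + n 1%N) * (n 2%N + n 5%N) * (n 3%N + n 4%N) + n 2%N * n 5%N * (n 0%N + n 1%N + (n 3%N + n 4%N))
    + n 0%N * n 1%N * (n 3%N + n 4%N) + n 3%N * n 4%N * (n 0%N + n 1%N)))%R.
Proof.
rewrite /= sum_ord6 !full_odeg_G26 !inordK //= !(INRD, INRM).
by rewrite /=; ring.
Qed.

(** Cloning never loses edges, so colourable relations suffice, and both patterns have the same
    maximum density 4/9 = 6 * 2/27. *)
Lemma oedges_le (V : finType) (h : V -> V -> V -> bool) : good h ->
  (INR (oedges h) <= 4 / 9 * INR #|V| ^ 3)%R.
Proof.
move: h; apply: symmetrization_ind => [h gh sy|h u v gh nuv duv IH]; last first.
  apply: Rle_trans IH; apply/INR_leq.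
  by have := clone_oedges (good_sym gh) nuv; lia.
have oE : oedges h = \sum_(x in [set: V]) odeg h [set: V] x by rewrite sum_setT.
rewrite -cardsT; have [[c Hc]|[c Hc]] := symmetrized_colorable gh sy.
- have /INR_leq := sum_full_odeg Hc; rewrite -oE.
  rewrite big_bool /= !full_odeg_semibipartite (card_classes _ c) big_bool /= !(INRD, INRM).
  have := pos_INR (nclass [set: V] c true); have := pos_INR (nclass [set: V] c false).
  rewrite (_ : INR 2 = 2%R) //.
  move: (INR _) (INR (nclass _ _ _)) (INR (nclass _ _ _)) => e a b b0 a0 le.
  (* Nine times the gap between 4/9 (a + b)^3 and 3 a b^2. *)
  have : (0 <= (2 * a - b) ^ 2 * (a + 4 * b))%R by apply: Rmul_sq_ge0; lra.
  lra.
- have /INR_leq := sum_full_odeg Hc; rewrite -oE sum_full_odeg_G26.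
  rewrite (card_classes _ c) sum_ord6 !INRD.
  have n0 k := pos_INR (nclass [set: V] c (inord k)).
  have := G26_lagrangian (n0 0) (n0 1) (n0 2) (n0 5) (n0 3) (n0 4).
  move: (INR _) (INR (nclass _ _ _)) (INR (nclass _ _ _)) (INR (nclass _ _ _))
    (INR (nclass _ _ _)) (INR (nclass _ _ _)) (INR (nclass _ _ _)) => e a b d f g k L le.
  by apply: Rle_trans le _; lra.
Qed.

(** Here [b ^ 2] and [2 * (a * b)] are the full degrees of the two colours; with [a + b <= 1] their
    lower bounds hold [b] near 2/3 from both sides. *)
Lemma semibipartite_sizes (a b gam : R) :
  (0 <= a -> 0 <= b -> a + b <= 1 -> 0 <= gam -> gam <= / 1000 ->
   4 / 9 - gam <= b ^ 2 -> 4 / 9 - gam <= 2 * (a * b) ->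
   [/\ / 7 <= a, / 7 <= b, b ^ 2 <= 4 / 9 + 5 * gam & 2 * (a * b) <= 4 / 9 + 5 * gam])%R.
Proof.
move=> a0 b0 ab g0 g1 hb hab.
have b1 : (2 / 3 - 2 * gam <= b)%R by nra.
have b2 : (b <= 2 / 3 + 3 * gam)%R by nra.
split; nra.
Qed.

(** The product is 25412184; [above] takes a variable so that no unary number of this size is
    evaluated. *)
Lemma exists_multiplier :
  exists2 m : nat, 216 * 7 ^ 6 < m & (INR m <= 26000000)%R.
Proof.
have above k : exists2 m, k < m & INR m = (INR k + 1)%R by exists k.+1; rewrite ?S_INR.
have [m m_gt E] := above (216 * 7 ^ 6); exists m; first exact: m_gt.
rewrite E INRM INRX.
have -> : INR 216 = 216%R by rewrite INR_IZR_INZ.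
have -> : INR 7 = 7%R by rewrite INR_IZR_INZ.
lra.
Qed.

(** 13 * 26000000 * 19 / 10^10 is below 1; the 19 leaves slack over the 16 / 10^10 that arises for
    [G26] in [extend_vertex]. *)
Lemma few_missing (m k n : nat) : (INR m <= 26000000)%R ->
  (INR k <= 19 / 10 ^ 10 * INR n ^ 2)%R -> 13 * m * k <= n ^ 2.
Proof.
move=> m1 k1; apply/INR_leq; rewrite INRX 2!INRM.
have -> : INR 13 = 13%R by rewrite INR_IZR_INZ.
have m0 := pos_INR m; have k0 := pos_INR k; have := pow2_ge_0 (INR n).
move: (INR n ^ 2)%R k1 => N2 k1 N0.
have : (13 * INR m * INR k <= 13 * 26000000 * INR k)%R by nra.
lra.
Qed.

Lemma card_leq7 (k n : nat) : (INR n * / 7 <= INR k)%R -> n <= 7 * k.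
Proof.
move=> H; apply/INR_leq; rewrite INRM; have -> : INR 7 = 7%R by rewrite INR_IZR_INZ.
lra.
Qed.

(* The constant 10^-22 only has to be small against the failure probability
   allowed by the union bound of generic_tuple. *)
Lemma extend_vertex (V : finType) (h : V -> V -> V -> bool) (W : {set V}) (v : V)
    (gam : R) :
  good h -> (0 <= gam)%R -> (gam <= / 10 ^ 22)%R ->
  ((1 - gam) * INR #|V| <= INR #|W|)%R ->
  (forall x, x \in W -> ((4 / 9 - gam) * INR #|V| ^ 2 <= INR (odeg h W x))%R) ->
  colorable h W -> colorable h (v |: W).
Proof.
move=> gh g0 g1 WN degW colW.
case: (boolP (v \in W)) => [vW|vW]; first by rewrite (setUidPr _) // sub1set.
have V0 : (0 < INR #|V|)%R by apply: lt_0_INR; apply/ltP; apply/card_gt0P; exists v.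
have WV : (INR #|W| <= INR #|V|)%R by apply/INR_leq; apply: max_card.
set N := INR #|V| in WN degW V0 WV *.
have g2 : (gam <= / 1000)%R by lra.
have N2 : (0 < N ^ 2)%R by nra.
have divN u : (0 <= u -> 0 <= u / N)%R.
  by move=> u0; apply: Rmult_le_pos => //; apply: Rlt_le; apply: Rinv_0_lt_compat.
have [m m_big m_le] := exists_multiplier.
have [x0 x0W] : exists x, x \in W.
  apply/set0Pn; rewrite -card_gt0 lt0n; apply/eqP => W0; rewrite W0 /= in WN; nra.
have missR (C : finType) (al : C -> C -> C -> bool) c x : coloring al h W c -> x \in W ->
   (INR (missing al h W c x) <= INR (full_odeg al W c (c x)) - (4 / 9 - gam) * N ^ 2)%R.
  by move=> cW xW; rewrite -(missing_odeg cW xW) INRD; have := degW x xW; lra.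
have degF (C : finType) (al : C -> C -> C -> bool) c x : coloring al h W c -> x \in W ->
   ((4 / 9 - gam) * N ^ 2 <= INR (full_odeg al W c (c x)))%R.
  by move=> cW xW; have := missR _ _ _ _ cW xW; have := pos_INR (missing al h W c x); lra.
case: colW => [[c cW]|[c cW]].
- set a := INR (nclass W c true); set b := INR (nclass W c false).
  have full t : INR (full_odeg exactly_one W c t) = if t then (b * b)%R else (2 * (a * b))%R.
    rewrite full_odeg_semibipartite; case: t; rewrite !INRM // (_ : INR 2 = 2%R) //.
  have WE : (INR #|W| = a + b)%R by rewrite (card_classes W c) big_bool INRD.
  have a0 : (0 <= a)%R by apply: pos_INR.
  have b0 : (0 <= b)%R by apply: pos_INR.
  have pos x : x \in W -> (0 < INR (full_odeg exactly_one W c (c x)))%R.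
    by move=> xW; have := degF _ _ _ _ cW xW; nra.
  have cls t : (0 < INR (nclass W c t))%R -> exists2 x, x \in W & c x = t.
    move=> H; have /card_gt0P[x] : 0 < nclass W c t by apply/ltP; apply: INR_lt.
    by rewrite inE => /andP[xW /eqP ct]; exists x.
  (* Both full degrees vanish for [b = 0]; and [a] is positive either through [x0] itself or through
     the factor [a] in its degree. *)
  have bp : (0 < b)%R by have := pos x0 x0W; rewrite full; case: (c x0); nra.
  have ap : (0 < a)%R.
    have := pos x0 x0W; rewrite full; case cx: (c x0) => H; last by nra.
    apply: lt_0_INR; apply/ltP/card_gt0P; exists x0; by rewrite inE x0W cx.
  have [xa xaW ca] := cls _ ap; have [xb xbW cb] := cls _ bp.
  have := degF _ _ _ _ cW xaW; have := degF _ _ _ _ cW xbW; rewrite !full ca cb => h1 h2.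
  have sa : a = (a / N * N)%R by field; lra.
  have sb : b = (b / N * N)%R by field; lra.
  have [|||||A7 B7 bb ab] := @semibipartite_sizes (a / N) (b / N) gam _ _ _ g0 g2.
  + by apply: divN.
  + by apply: divN.
  + apply: (Rmult_le_reg_r N) => //; rewrite Rmult_plus_distr_r -sa -sb; lra.
  + by apply: (Rmult_le_reg_r (N ^ 2)) => //; rewrite (_ : (_ / _) ^ 2 * _ = b * b)%R //; field; lra.
  + by apply: (Rmult_le_reg_r (N ^ 2)) => //; rewrite (_ : 2 * _ * _ = 2 * (a * b))%R //; field; lra.
  have bb' : (b * b <= (4 / 9 + 5 * gam) * N ^ 2)%R.
    have := Rmult_le_compat_r (N ^ 2) _ _ (Rlt_le _ _ N2) bb.
    by rewrite (_ : (_ / _) ^ 2 * _ = b * b)%R //; field; lra.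
  have ab' : (2 * (a * b) <= (4 / 9 + 5 * gam) * N ^ 2)%R.
    have := Rmult_le_compat_r (N ^ 2) _ _ (Rlt_le _ _ N2) ab.
    by rewrite (_ : 2 * _ * _ = 2 * (a * b))%R //; field; lra.
  apply: (extend_semibipartite gh cW vW _ m_big) => [t|x xW].
    apply: card_leq7; rewrite -/N -/(nclass W c t); case: t; rewrite -/a -/b.
      by rewrite sa; nra.
    by rewrite sb; nra.
  apply: few_missing => //; have := missR _ _ _ _ cW xW; rewrite full -/N => H.
  have : (INR (missing exactly_one h W c x) <= (6 * gam) * N ^ 2)%R by move: H; case: (c x); lra.
  by move=> H'; apply: Rle_trans H' _; apply: Rmult_le_compat_r; lra.
- set n := fun k => INR (nclass W c (inord k)).
  have n0 k : (0 <= n k)%R by apply: pos_INR.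
  have WE : INR #|W| = (n 0%N + n 1%N + n 2%N + n 3%N + n 4%N + n 5%N)%R.
    by rewrite (card_classes W c) sum_ord6 !INRD.
  have := sum_full_odeg cW => /INR_leq; rewrite sum_full_odeg_G26 -!/(n _) => Lu.
  have Ll : (INR #|W| * ((4 / 9 - gam) * N ^ 2) <= INR (\sum_(x in W) odeg h W x))%R.
    exact: (INR_sum_ge (P := mem W)).
  pose y k := (n k / N)%R.
  have yN k : n k = (y k * N)%R by rewrite /y; field; lra.
  have y0 k : (0 <= y k)%R by apply: divN.
  (* For eta = 10^-10 stability asks for [32 * gam <= eta ^ 2], that is 10^-20, which the bound
     10^-22 on [gam] meets. *)
  have eta0 : (0 < / 10 ^ 10)%R by lra.
  have L : (2 / 27 - gam <= (y 0%N + y 1%N) * (y 2%N + y 5%N) * (y 3%N + y 4%N)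
      + y 2%N * y 5%N * (y 0%N + y 1%N + (y 3%N + y 4%N))
      + y 0%N * y 1%N * (y 3%N + y 4%N) + y 3%N * y 4%N * (y 0%N + y 1%N))%R.
    apply: (Rmult_le_reg_r (N ^ 3)); first by nra.
    apply: (Rle_trans _ ((1 - gam) * N * ((4 / 9 - gam) * N ^ 2) / 6)).
      have N3 : (0 < N ^ 3)%R by nra.
      rewrite (_ : (_ * _ * _ / 6 = ((1 - gam) * (4 / 9 - gam) / 6) * N ^ 3)%R); last by field.
      by apply: Rmult_le_compat_r; [lra | nra].
    have : ((1 - gam) * N * ((4 / 9 - gam) * N ^ 2) <= INR #|W| * ((4 / 9 - gam) * N ^ 2))%R.
      by apply: Rmult_le_compat_r; [nra | lra].
    have := Rle_trans _ _ _ Ll Lu; rewrite !yN; lra.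
  have sy : (y 0%N + y 1%N + y 2%N + y 5%N + y 3%N + y 4%N = INR #|W| / N)%R.
    by rewrite WE /y; field; lra.
  have [||||[b0 b1 b2] [b5 b3 b4]] := @G26_lagrangian_stable (y 0%N) (y 1%N) (y 2%N) (y 5%N)
    (y 3%N) (y 4%N) (/ 10 ^ 10) gam (y0 _) (y0 _) (y0 _) (y0 _) (y0 _) (y0 _) eta0 _ g0 _ _ _ L.
  + lra.
  + lra.
  + rewrite sy; apply: (Rmult_le_reg_r N) => //.
    by rewrite (_ : (_ / _ * _ = INR #|W|)%R); [lra | field; lra].
  + rewrite sy; apply: (Rmult_le_reg_r N) => //.
    by rewrite (_ : (_ / _ * _ = INR #|W|)%R); [lra | field; lra].
  have bnd k : k < 6 -> (/ 7 <= y k <= / 6 + 3 / 10 ^ 10)%R.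
    have conv u : (Rabs (u - / 6) <= 3 * / 10 ^ 10 -> / 7 <= u <= / 6 + 3 / 10 ^ 10)%R.
      by rewrite /Rabs; case: Rcase_abs => ? ?; lra.
    by case: k => [|[|[|[|[|[|k]]]]]] // _; apply: conv.
  have prod k l : k < 6 -> l < 6 -> (n k * n l <= (/ 6 + 3 / 10 ^ 10) ^ 2 * N ^ 2)%R.
    move=> /bnd kb /bnd lb; rewrite !yN.
    rewrite (_ : y k * N * (y l * N) = y k * y l * N ^ 2)%R; last by ring.
    by apply: Rmult_le_compat_r; [lra | nra].
  (* A vertex of [G26] lies in 8 edges, giving 16 ordered pairs of classes; 16 / 36 = 4 / 9 is the
     balanced value. *)
  have full i : (INR (full_odeg g26 W c i) <= 16 * ((/ 6 + 3 / 10 ^ 10) ^ 2 * N ^ 2))%R.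
    have := prod 0 1 isT isT; have := prod 0 2 isT isT; have := prod 0 3 isT isT.
    have := prod 0 4 isT isT; have := prod 0 5 isT isT; have := prod 1 2 isT isT.
    have := prod 1 3 isT isT; have := prod 1 4 isT isT; have := prod 1 5 isT isT.
    have := prod 2 3 isT isT; have := prod 2 4 isT isT; have := prod 2 5 isT isT.
    have := prod 3 4 isT isT; have := prod 3 5 isT isT; have := prod 4 5 isT isT.
    move: i; apply: ord6_ind; rewrite full_odeg_G26 inordK //= !(INRD, INRM) -!/(n _);
      rewrite (_ : INR 2 = 2%R) //;
      move: (n 0) (n 1) (n 2) (n 3) (n 4) (n 5) (_ * N ^ 2)%R => *; lra.
  apply: (extend_G26 gh cW vW _ m_big) => [t|x xW].
    apply: card_leq7; rewrite -/N -/(nclass W c t).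
    have := bnd t (ltn_ord t); have := yN t; rewrite /n inord_val => -> ?; nra.
  apply: few_missing => //; have := missR _ _ _ _ cW xW; have := full (c x); rewrite -/N => f1 f2.
  apply: (Rle_trans _ ((16 * (/ 6 + 3 / 10 ^ 10) ^ 2 - (4 / 9 - gam)) * N ^ 2)); first by lra.
  by apply: Rmult_le_compat_r; lra.
Qed.

(** * Removing vertices of low degree *)

Lemma sum_in_le (I : finType) (A : {set I}) (F : I -> nat) m :
  (forall i, F i <= m) -> \sum_(i in A) F i <= #|A| * m.
Proof. by move=> Fm; rewrite -sum_nat_const; apply: leq_sum. Qed.

Lemma sum_setC (I : finType) (A : {set I}) (F : I -> nat) :
  \sum_i F i = \sum_(i in A) F i + \sum_(i in ~: A) F i.
Proof.
rewrite (bigID (mem A)) /=; congr (_ + _).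
by apply: eq_bigl => i; rewrite !inE.
Qed.

Lemma odeg_restrict (V : finType) (h : V -> V -> V -> bool) (W : {set V}) x :
  odeg h [set: V] x <= odeg h W x + 2 * (#|~: W| * #|V|).
Proof.
rewrite odegT (sum_setC W) mul2n -addnn addnA; apply: leq_add; last first.
  by apply: sum_in_le => y; apply: sum_bool_le.
rewrite (eq_bigr (fun y => \sum_(z in W) h x y z + \sum_(z in ~: W) (h x y z : nat))).
  rewrite big_split /= leq_add2l exchange_big /=; apply: sum_in_le => z.
  exact: sum_bool_le.
by move=> y _; rewrite (sum_setC W).
Qed.

(** A lost triple has an entry outside [A] in one of three positions. *)
Lemma oedges_delete (V : finType) (h : V -> V -> V -> bool) (A : {set V}) : sym3 h ->
  oedges h <= oedges (fun x y z : {x | x \in A} => h (val x) (val y) (val z))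
    + 3 * \sum_(x in ~: A) odeg h [set: V] x.
Proof.
move=> sh.
have -> : oedges (fun x y z : {x | x \in A} => h (val x) (val y) (val z)) =
    \sum_(x in A) \sum_(y in A) \sum_(z in A) h x y z.
  rewrite (big_sub (mem A) (fun x => \sum_(y in A) \sum_(z in A) h x y z)).
  apply: eq_bigr => x _; rewrite odegT (big_sub (mem A) (fun y => \sum_(z in A) h (val x) y z)).
  by apply: eq_bigr => y _; rewrite (big_sub (mem A) (fun z => h (val x) (val y) z : nat)).
rewrite /oedges (sum_setC A) mulSn mul2n -addnn addnA [X in _ <= X]addnAC addnA.
rewrite leq_add2r.
have D1 : \sum_(y in ~: A) odeg h [set: V] y = \sum_x \sum_(y in ~: A) \sum_z h x y z.
  rewrite [RHS]exchange_big; apply: eq_bigr => y _; rewrite odegT.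
  by apply: eq_bigr => x _; apply: eq_bigr => z _; rewrite (sym3l sh).
have D2 : \sum_(z in ~: A) odeg h [set: V] z = \sum_x \sum_y \sum_(z in ~: A) h x y z.
  rewrite [RHS](eq_bigr (fun x => \sum_(z in ~: A) \sum_y (h x y z : nat))); last first.
    by move=> x _; rewrite exchange_big.
  rewrite [RHS]exchange_big; apply: eq_bigr => z _; rewrite odegT.
  apply: eq_bigr => x _; apply: eq_bigr => y _; by rewrite (sym3l sh) (sym3r sh).
have le_sub (F : V -> nat) : \sum_(x in A) F x <= \sum_x F x.
  by rewrite (sum_setC A) leq_addr.
rewrite {1}D1 D2.
apply: leq_trans (_ : \sum_(x in A) (\sum_(y in A) \sum_(z in A) h x y z +
   \sum_(y in ~: A) \sum_z h x y z + \sum_y \sum_(z in ~: A) h x y z) <= _).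
  apply: leq_sum => x _; rewrite odegT (sum_setC A) -addnA addnC [X in _ <= X]addnC.
  rewrite -addnA leq_add2l.
  rewrite [X in _ <= X]addnC.
  rewrite (eq_bigr (fun y => \sum_(z in A) h x y z + \sum_(z in ~: A) (h x y z : nat))).
    by rewrite big_split leq_add2l.
  by move=> y _; rewrite (sum_setC A).
rewrite !big_split /=; apply: leq_add; [apply: leq_add => // | ]; exact: le_sub.
Qed.

Lemma nat_above (r : R) : (0 <= r)%R -> exists k : nat, (r <= INR k <= r + 1)%R.
Proof.
move=> r0; have [a1 a2] := archimed r.
have z0 : (0 <= up r)%Z by apply: le_IZR; lra.
by have [k E] := IZN _ z0; exists k; rewrite INR_IZR_INZ -E; lra.
Qed.

(** In ordinary degrees the threshold is 2/9 - 3 sg; [sg] stands for the square root of [eps]. *)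
Definition low_degree (V : finType) (h : V -> V -> V -> bool) (sg : R) : {set V} :=
  [set x | if Rlt_dec (INR (odeg h [set: V] x)) ((4 / 9 - 6 * sg) * INR #|V| ^ 2)
           then true else false].

Lemma low_degreeP (V : finType) (h : V -> V -> V -> bool) sg x :
  reflect (INR (odeg h [set: V] x) < (4 / 9 - 6 * sg) * INR #|V| ^ 2)%R
    (x \in low_degree h sg).
Proof. by rewrite inE; case: Rlt_dec => H; constructor. Qed.

(** Deleting about 2 sg N low vertices would leave more than [oedges_le] allows on the rest: with t
    = sg N and k deleted vertices, the saving 18 t k outweighs the initial deficit 6 t^2 plus the
    second-order term 4/3 k^2. *)
Lemma card_low_degree (V : finType) (h : V -> V -> V -> bool) (sg : R) :
  good h -> (0 < sg)%R -> (sg <= / 100)%R -> (1 <= sg * INR #|V|)%R ->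
  ((4 / 9 - 6 * sg ^ 2) * INR #|V| ^ 3 <= INR (oedges h))%R ->
  (INR #|low_degree h sg| < 3 * sg * INR #|V|)%R.
Proof.
move=> gh s0 s1 sN many; apply: Rnot_le_lt => Zbig.
set N := INR #|V| in many sN Zbig *; have N0 : (0 < N)%R by nra.
(* Rounding up stays below 3 sg N because 1 <= sg N. *)
have [|k [k1 k2]] := @nat_above (2 * sg * N)%R; first by nra.
have kZ : k <= #|low_degree h sg| by apply/INR_leq; lra.
have [|B [_ BZ Bk]] := @subset_between _ set0 (low_degree h sg) k (sub0set _) _ kZ.
  by rewrite cards0.
have := oedges_delete (~: B) (good_sym gh); rewrite setCK => /INR_leq.
rewrite INRD INRM (_ : INR 3 = 3%R); last by rewrite /=; lra.
have := oedges_le (good_pullback (fun x : {x | x \in ~: B} => val x) gh).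
have -> : INR #|{: {x | x \in ~: B}}| = (N - INR k)%R.
  have -> : #|{: {x | x \in ~: B}}| = #|~: B| by rewrite card_sig; apply: eq_card.
  by have := cardsC B; rewrite Bk => /(congr1 INR); rewrite INRD -/N; lra.
have low : (INR (\sum_(x in B) odeg h [set: V] x) <= INR k * ((4 / 9 - 6 * sg) * N ^ 2))%R.
  rewrite -Bk -sum1_card; apply: (big_ind2 (fun m l => (INR l <= INR m * ((4 / 9 - 6 * sg) * N ^ 2))%R)).
  - by rewrite /=; lra.
  - by move=> a1 b1 a2 b2; rewrite !INRD; lra.
  - by move=> x /(subsetP BZ)/low_degreeP; rewrite -/N /=; lra.
move: many low k1 k2; set e := INR (oedges h); set b := INR (\sum_(x in B) _).
move: (INR (oedges _)) (INR k) => d z many low z1 z2 d1 d2.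
have z3 : (z <= 3 * (sg * N))%R by lra.
have zz : (z * z <= 9 * (sg * N) ^ 2)%R by nra.
have tz : (2 * (sg * N) ^ 2 <= sg * N * z)%R by nra.
have zp : (0 <= z ^ 3)%R by apply: pow_le; lra.
have Nz : (N * (4 / 3 * (z * z) + 6 * (sg * N) ^ 2 - 18 * (sg * N * z)) <= N * (- 1))%R.
  by apply: Rmult_le_compat_l; nra.
nra.
Qed.

(** Restricting to a set that misses at most 7 sg N vertices costs at most 14 sg N^2 ordered pairs,
    and 6 + 14 = 20 is the loss passed to [extend_vertex]. *)
Lemma colorable_extension (V : finType) (h : V -> V -> V -> bool) (W0 W : {set V})
    (sg : R) :
  good h -> (0 < sg)%R -> (20 * sg <= / 10 ^ 22)%R ->
  W0 \subset W -> (INR #|~: W0| <= 7 * sg * INR #|V|)%R ->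
  (forall x, x \in W -> ((4 / 9 - 6 * sg) * INR #|V| ^ 2 <= INR (odeg h [set: V] x))%R) ->
  colorable h W0 -> colorable h W.
Proof.
move=> gh s0 s1; move: {2}#|W :\: W0| (leqnn #|W :\: W0|) => k.
elim: k W0 => [|k IH] W0 Wk sub c7 degW colW.
  suff -> : W = W0 by [].
  apply/eqP; rewrite eqEsubset sub andbT -setD_eq0 -cards_eq0.
  by rewrite -leqn0.
case: (set_0Vmem (W :\: W0)) => [/eqP|[v]].
  by rewrite setD_eq0 => WW0; rewrite (_ : W = W0) //; apply/eqP; rewrite eqEsubset WW0.
rewrite inE => /andP[vW0 vW]; apply: (IH (v |: W0)) => //.
- have := cardsD1 v (W :\: W0); rewrite inE vW0 vW /= => E.
  rewrite (_ : W :\: (v |: W0) = (W :\: W0) :\ v); first by lia.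
  by apply/setP => x; rewrite !inE negb_or andbA.
- by rewrite subUset sub1set vW.
- apply: Rle_trans c7; apply/INR_leq/subset_leq_card; rewrite setCS; exact: subsetUr.
apply: (extend_vertex v (gam := (20 * sg)%R) gh) => //; first by lra.
- have := cardsC W0 => /(congr1 INR); rewrite INRD; have := pos_INR #|V|; nra.
move=> x /(subsetP sub)/degW; have /INR_leq := odeg_restrict h W0 x.
rewrite INRD !INRM (_ : INR 2 = 2%R) //.
have : (INR #|~: W0| * INR #|V| <= 7 * sg * INR #|V| * INR #|V|)%R.
  by apply: Rmult_le_compat_r => //; apply: pos_INR.
move: (INR #|V|) (INR (odeg h W0 x)) => N a; rewrite (_ : (N ^ 2 = N * N)%R); last by ring.
lra.
Qed.

(** Away from [v] a relation and its clone agree, so the colouring of the clone is valid off [Z];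
    the high vertices of [h] inside [Z] are then restored one at a time. *)
Lemma colorable_high_degree (V : finType) (h : V -> V -> V -> bool) (sg : R) :
  good h -> (0 < sg)%R -> (20 * sg <= / 10 ^ 22)%R -> (1 <= sg * INR #|V|)%R ->
  ((4 / 9 - 6 * sg ^ 2) * INR #|V| ^ 3 <= INR (oedges h))%R ->
  colorable h (~: low_degree h sg).
Proof.
move=> gh s0 s1 sN; move: h gh; apply: symmetrization_ind => [h gh sy _|h u v gh nuv duv IH many].
  exact: colorable_sub (subsetT _) (symmetrized_colorable gh sy).
set h' := fun x y z => _ in IH.
have many' : ((4 / 9 - 6 * sg ^ 2) * INR #|V| ^ 3 <= INR (oedges h'))%R.
  apply: Rle_trans many _; apply/INR_leq.
  by have := clone_oedges (good_sym gh) nuv; rewrite -/h'; lia.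
have gh' : good h' := good_pullback (clone u v) gh.
have s2 : (sg <= / 100)%R by lra.
have Z1 := card_low_degree gh s0 s2 sN many.
have Z2 := card_low_degree gh' s0 s2 sN many'.
(* Fewer than 3 sg N + 1 + 3 sg N vertices, hence at most 7 sg N since 1 <= sg N. *)
pose Z := low_degree h sg :|: (v |: low_degree h' sg).
apply: (@colorable_extension _ h (~: Z) _ sg gh s0 s1).
- by rewrite setCS subsetUl.
- rewrite setCK.
  have : #|Z| <= #|low_degree h sg| + (1 + #|low_degree h' sg|).
    apply: leq_trans (leq_card_setU _ _) _; rewrite leq_add2l.
    by apply: leq_trans (leq_card_setU _ _) _; rewrite cards1.
  move=> /INR_leq; rewrite !INRD (_ : INR 1 = 1%R) //; lra.
- by move=> x; rewrite inE => /low_degreeP; lra.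
have off x : x \in ~: Z -> x \in ~: low_degree h' sg /\ clone u v x = x.
  by rewrite !inE !negb_or /clone => /and3P[_ /negbTE-> ->].
have hE x y z : x \in ~: Z -> y \in ~: Z -> z \in ~: Z -> h x y z -> h' x y z.
  by move=> /off[_ xE] /off[_ yE] /off[_ zE]; rewrite /h' xE yE zE.
have [[c Hc]|[c Hc]] := IH many'; [left|right]; exists c => x y z xZ yZ zZ hxyz;
  by apply: Hc; rewrite ?(proj1 (off _ xZ)) ?(proj1 (off _ yZ)) ?(proj1 (off _ zZ)) //; apply: hE.
Qed.

(** * Return to edge sets, and the theorem *)

Lemma card_completions (V : finType) (e : {set V}) (x : V) :
  #|e| = 3 -> x \in e -> \sum_y \sum_z ([set x; y; z] == e) = 2.
Proof.
move=> e3 xe; have /cards2P[a [b [ab E]]] : #|e :\ x| == 2.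
  by move: (cardsD1 x e); rewrite xe e3; lia.
have : x \notin e :\ x by rewrite !inE eqxx.
rewrite E !inE negb_or => /andP[xa xb].
have eE : e = [set x; a; b] by rewrite -(setD1K xe) E setUA.
rewrite pair_bigA /= -(_ : #|[set (a, b); (b, a)]| = 2); last first.
  by rewrite cards2 xpair_eqE (negbTE ab).
rewrite -sum1_card [RHS]big_mkcond /=; apply: eq_bigr => -[y z] _ /=.
rewrite eE eq_sym set3_eq // !inE !xpair_eqE eqxx /=.
rewrite (eq_sym a x) (negbTE xa) (eq_sym b x) (negbTE xb) /= !(eq_sym _ a) !(eq_sym _ b).
case: (eqVneq a y) => [<-|_] /=; rewrite ?(eq_sym b a) ?(negbTE ab) /=.
  by rewrite orbF; case: (b == z).
by case: (eqVneq a z) => [<-|_]; rewrite ?(eq_sym b a) ?(negbTE ab) ?andbF ?andbT ?orbF /=; case: (b == y).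
Qed.

Lemma odeg_degIn (V : finType) (H : {set {set V}}) (W : {set V}) (x : V) :
  is3graph H -> x \in W -> odeg (triple H) W x = 2 * degIn H W x.
Proof.
move=> H3 xW; pose E := [set e in H | (e \subset W) && (x \in e)].
have -> : odeg (triple H) W x = \sum_y \sum_z ([set x; y; z] \in E).
  rewrite /odeg big_mkcond; apply: eq_bigr => y _.
  case: ifP => yW; last by rewrite big1 // => z _; rewrite inE set3_sub yW !andbF.
  rewrite big_mkcond; apply: eq_bigr => z _.
  rewrite inE set3_sub xW yW !inE eqxx /= andbT /triple.
  by case: (z \in W); rewrite ?andbT ?andbF.
rewrite (eq_bigr (fun y => \sum_(e in E) \sum_z ([set x; y; z] == e))); last first.
  move=> y _; rewrite exchange_big; apply: eq_bigr => z _.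
  case: (boolP (_ \in E)) => [sE|sE].
    by rewrite (bigD1 [set x; y; z]) //= eqxx big1 // => e /andP[_]; rewrite eq_sym => /negbTE->.
  by rewrite big1 // => e eE; case: eqP => // s_e; rewrite s_e eE in sE.
rewrite exchange_big (eq_bigr (fun=> 2)) => [|e]; last first.
  by rewrite inE => /and3P[/H3 e3 _ xe]; rewrite card_completions.
by rewrite sum_nat_const mulnC.
Qed.

Lemma oedges_triple (V : finType) (H : {set {set V}}) :
  is3graph H -> oedges (triple H) = 6 * #|H|.
Proof.
move=> H3; rewrite /oedges (eq_bigr (fun x => 2 * \sum_(e in H) (x \in e))); last first.
  move=> x _; rewrite odeg_degIn ?inE //; congr (2 * _).
  rewrite /degIn -sum1_card big_mkcond [RHS]big_mkcond; apply: eq_bigr => e _.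
  by rewrite inE subsetT /=; case: (e \in H); case: (x \in e).
rewrite -big_distrr exchange_big /= (eq_bigr (fun=> 3)).
  by rewrite sum_nat_const mulnCA mulnC.
move=> e /H3 <-; rewrite -sum1_card big_mkcond [RHS]big_mkcond.
by apply: eq_bigr => x _; case: (x \in e).
Qed.

Lemma semibipartiteOn_coloring (V : finType) (H : {set {set V}}) (W : {set V}) c :
  is3graph H -> coloring exactly_one (triple H) W c -> semibipartiteOn H W.
Proof.
move=> H3 Hc; exists [set x in W | c x]; split=> [|e eH eW].
  by apply/subsetP => x; rewrite inE => /andP[].
have [x [y [z [xy xz yz E]]]] := cards3P (H3 e eH).
have := eW; rewrite E set3_sub => /and3P[xW yW zW].
have := Hc x y z xW yW zW; rewrite /triple -E => /(_ eH).
have -> : e :&: [set t in W | c t] = [set t in e | c t].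
  by apply/setP => t; rewrite !inE; case: (boolP (t \in e)) => // /(subsetP eW) ->.
have -> : e :&: (W :\: [set t in W | c t]) = [set t in e | ~~ c t].
  apply/setP => t; rewrite !inE; case: (boolP (t \in e)) => // /(subsetP eW) ->.
  by rewrite andbT.
by rewrite E !card_set3_filter //; case: (c x); case: (c y); case: (c z).
Qed.

Lemma G26colorableOn_coloring (V : finType) (H : {set {set V}}) (W : {set V}) c :
  is3graph H -> coloring g26 (triple H) W c -> G26colorableOn H W.
Proof.
move=> H3 Hc.
(* [surjP] asks for six nonempty parts even if [c] misses a colour; one extra vertex per part
   provides them. *)
exists (V + 'I_6)%type, (fun u => match u with inl x => c x | inr i => i end).
split=> [i|]; first by exists (inr i).
exists inl; split=> [x y _ _ [] //|e eH eW].
have [x [y [z [xy xz yz E]]]] := cards3P (H3 e eH).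
have := eW; rewrite E set3_sub => /and3P[xW yW zW].
have := Hc x y z xW yW zW; rewrite /triple -E => /(_ eH) g.
rewrite inE card_imset ?H3 // => [|? ? [] //].
by rewrite E !imset_set3 -/(g26 _ _ _) g andbT cards3 //; have [] := sym3_neq g26_sym g.
Qed.

Theorem theorem6p1 :
  exists eps0 : R, (0 < eps0)%R /\
  forall eps : R, (0 < eps)%R -> (eps < eps0)%R ->
  exists n0 : nat, forall (n : nat) (V : finType) (H : {set {set V}}),
    n0 <= n -> #|V| = n -> is3graph H -> Mfree H ->
    (2 * INR n ^ 3 / 27 - eps * INR n ^ 3 <= INR #|H|)%R ->
    exists W : {set V},
      (INR n - 3 * sqrt eps * INR n < INR #|W|)%R /\
      (forall v, v \in W ->
         (2 * INR n ^ 2 / 9 - 20 * sqrt eps * INR n ^ 2 <= INR (degIn H W v))%R) /\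
      (semibipartiteOn H W \/ G26colorableOn H W).
Proof.
(* This makes [sg] less than 10^-24, hence [20 * sg] at most 10^-22. *)
exists ((/ 10 ^ 24) ^ 2)%R; split; first by lra.
move=> eps e0 e1; set sg := sqrt eps.
have s0 : (0 < sg)%R by apply: sqrt_lt_R0.
have sE : (sg ^ 2 = eps)%R by apply: pow2_sqrt; lra.
have s1 : (20 * sg <= / 10 ^ 22)%R.
  have : (sg < / 10 ^ 24)%R; last by lra.
  by rewrite -sE in e1; nra.
have [n0 [n0P _]] : exists k : nat, (/ sg <= INR k <= / sg + 1)%R.
  by apply: nat_above; apply: Rlt_le; apply: Rinv_0_lt_compat.
exists n0 => n V H n0n Vn H3 MF many.
have gh := Mfree_good H3 MF; pose h := triple H.
have sN : (1 <= sg * INR #|V|)%R.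
  have nn : (/ sg <= INR n)%R by move/INR_leq: n0n; lra.
  by rewrite Vn -(Rinv_r sg); [apply: Rmult_le_compat_l; lra | lra].
have many' : ((4 / 9 - 6 * sg ^ 2) * INR #|V| ^ 3 <= INR (oedges h))%R.
  rewrite oedges_triple // INRM Vn sE (_ : INR 6 = 6%R); last by rewrite INR_IZR_INZ.
  by lra.
have s2 : (sg <= / 100)%R by lra.
have Z3 : (INR #|low_degree h sg| < 3 * sg * INR #|V|)%R by apply: card_low_degree.
exists (~: low_degree h sg); split.
  have : (INR #|low_degree h sg| + INR #|~: low_degree h sg| = INR n)%R.
    by rewrite -INRD cardsC Vn.
  by rewrite Vn in Z3; lra.
(* Losing fewer than 3 sg n vertices costs at most 6 sg n^2 ordered pairs, so half of 4/9 - 12 sg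
   remains, within the claimed bound. *)
split=> [v vZ|].
  have := vZ; rewrite in_setC => /low_degreeP/Rnot_lt_le dv.
  have /INR_leq := odeg_restrict h (~: low_degree h sg) v.
  rewrite setCK (odeg_degIn H3 vZ) INRD !INRM (_ : INR 2 = 2%R) //.
  have V0 := pos_INR #|V|.
  have : (INR #|low_degree h sg| * INR #|V| <= 3 * sg * INR #|V| * INR #|V|)%R by nra.
  rewrite Vn in dv V0 *; move: (INR n) (INR (degIn _ _ _)) dv V0 => N a dv V0.
  have N2 : (0 <= N ^ 2)%R by nra.
  rewrite (_ : (3 * sg * N * N = 3 * (sg * N ^ 2))%R); last by ring.
  have : (0 <= sg * N ^ 2)%R by nra.
  lra.
have [[c Hc]|[c Hc]] := colorable_high_degree gh s0 s1 sN many'; [left|right].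
  exact: semibipartiteOn_coloring Hc.
exact: G26colorableOn_coloring Hc.
Qed.
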